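(* Let $w\in\mathcal W$. We have the strict inclusions $$\mathcal X(\mathcal H^2_{w,0})\subsetneq\big(\mathcal H^2_{w,0}\odot\mathcal H^2_{w,0}\big)^*,\qquad \mathcal X_w\subsetneq\big(\mathcal H^2_w\odot\mathcal H^2_w\big)^*.$$
   Context: $\mathcal D$ is the class of functions represented by a convergent Dirichlet series in some half-plane. Weights: $w=(w_n)_{n\ge1}$ belongs to $\mathcal W$ if, for some real $\beta>0$, either $w_n=[d(n)]^\beta$ for all $n$ ($d(n)$ the number of divisors of $n$), or $w_n=d_{\beta+1}(n)$ for all $n$, where $\zeta(s)^\gamma=\sum_{n\ge1}d_\gamma(n)n^{-s}$. $\mathcal H^2_w$ is the Hilbert space of Dirichlet series $f(s)=\sum_{n\ge1}a_n n^{-s}$ with $\|f\|_{\mathcal H^2_w}^2=\sum_{n\ge1}|a_n|^2/w_n<\infty$, with inner product $\langle \sum a_nn^{-s},\sum b_nn^{-s}\rangle_{\mathcal H^2_w}=\sum_{n}a_n\overline{b_n}/w_n$; $\mathcal H^2_{w,0}=\{f\in\mathcal H^2_w: f(+\infty)=0\}$ is the subspace of series with zero constant term $a_1=0$. Volterra operator: $T_gf(s)=-\int_s^{+\infty}f(u)g'(u)\,du$, $\Re s>1/2$; in terms of coefficients, if $f=\sum a_nn^{-s}$ and $g=\sum b_nn^{-s}$, then $T_gf(s)=\sum_{n\ge2}\frac1{\log n}\big(\sum_{k\mid n,\,k<n}a_k b_{n/k}\log(n/k)\big)n^{-s}$. $\mathcal X_w=\mathcal X(\mathcal H^2_w)$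 (resp. $\mathcal X(\mathcal H^2_{w,0})$) is the set of $g\in\mathcal D$ for which $T_g$ is bounded on $\mathcal H^2_w$ (resp. on $\mathcal H^2_{w,0}$). For $\mathcal Y=\mathcal H^2_w$ or $\mathcal H^2_{w,0}$, the weak product $\mathcal Y\odot\mathcal Y$ is the Banach space defined as the closure of all finite sums $F=\sum_kf_kh_k$, $f_k,h_k\in\mathcal Y$, under the norm $\|F\|=\inf\sum_k\|f_k\|_{\mathcal H^2_w}\|h_k\|_{\mathcal H^2_w}$, infimum over all finite representations $F=\sum_kf_kh_k$. Its dual is taken with respect to the $\mathcal H^2_w$-pairing: a Dirichlet series $\phi$ is in $(\mathcal Y\odot\mathcal Y)^*$ if $F\mapsto\langle F,\phi\rangle_{\mathcal H^2_w}$, defined on Dirichlet polynomials in $\mathcal Y\odot\mathcal Y$, extends to a bounded functional; equivalently the Hankel form $H_\phi(fh)=\langle fh,\phi\rangle_{\mathcal H^2_w}$ satisfies $|H_\phi(fh)|\le C\|f\|_{\mathcal H^2_w}\|h\|_{\mathcal H^2_w}$ for all Dirichlet polynomials $f,h\in\mathcal Y$. *)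

(* Defs.v *)
From mathcomp Require Import all_boot all_order all_algebra.
From mathcomp Require Import all_classical all_reals all_analysis.
From mathcomp Require Import complex.

Set Implicit Arguments.
Unset Strict Implicit.
Unset Printing Implicit Defensive.

Import Order.TTheory GRing.Theory Num.Theory.
Import numFieldNormedType.Exports.

Local Open Scope classical_set_scope.
Local Open Scope ring_scope.
Local Open Scope complex_scope.

(* A Dirichlet series sum_(n >= 1) a_n n^{-s} is its coefficient sequence
   a : nat -> R[i]; the entry a 0 is meaningless and is never read. *)
Definition dseries (R : realType) : Type := nat -> R[i].

(* n^{-s} = n^{-Re s} e^{- i Im s log n}, for n >= 1 *)
Definition nat_cpow_opp (R : realType) (n : nat) (s : R[i]) : R[i] :=
  (n%:R `^ (- complex.Re s))%:C *
  (cos (complex.Im s * ln n%:R) -i* sin (complex.Im s * ln n%:R)).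

Definition class_D (R : realType) : set (dseries R) :=
  [set a | exists sigma : R, forall s : R[i], sigma < complex.Re s ->
     cvgn ((fun N => \sum_(1 <= n < N) a n * nat_cpow_opp n s) :
             nat -> R[i]^o)].

Definition zeta (R : realType) (s : R) : R :=
  limn (fun N => \sum_(1 <= n < N) (n%:R : R) `^ (- s)).

(* The identity zeta(s)^gamma = sum_(n >= 1) c_n n^{-s} on the real half-line
   s > 1, where zeta(s) > 1 and the power is the ordinary real one; by
   uniqueness of Dirichlet coefficients it determines c_n for n >= 1. *)
Definition zeta_power_coeffs (R : realType) (gamma : R) (c : nat -> R) : Prop :=
  forall s : R, 1 < s ->
    (\sum_(1 <= n < N) c n * n%:R `^ (- s)) @[N --> \oo] --> zeta s `^ gamma.

Definition weight_class (R : realType) : set (nat -> R) :=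
  [set w | exists beta : R, 0 < beta /\
     ((forall n, (0 < n)%N -> w n = (size (divisors n))%:R `^ beta) \/
      zeta_power_coeffs (beta + 1) w)].

Definition H2_sqnorm (R : realType) (w : nat -> R) (a : dseries R) : \bar R :=
  (\sum_(1 <= n <oo) (ComplexField.Normc.normc (a n) ^+ 2 / w n)%:E)%E.

Definition H2_norm (R : realType) (w : nat -> R) (a : dseries R) : R :=
  Num.sqrt (fine (H2_sqnorm w a)).

Definition H2_inner (R : realType) (w : nat -> R) (a b : dseries R) : R[i] :=
  limn ((fun N => \sum_(1 <= n < N) a n * (b n)^* / (w n)%:C) :
          nat -> R[i]^o).

Definition H2 (R : realType) (w : nat -> R) : set (dseries R) :=
  [set a | (H2_sqnorm w a < +oo)%E].

(* f(+oo) is the constant coefficient a_1. *)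
Definition H2_0 (R : realType) (w : nat -> R) : set (dseries R) :=
  [set a | H2 w a /\ a 1%N = 0].

(* Coefficients of T_g f(s) = - int_s^{+oo} f(u) g'(u) du; for n = 1 the inner
   sum is empty. *)
Definition volterra (R : realType) (g f : dseries R) : dseries R := fun n =>
  ((ln (n%:R : R))^-1)%:C *
  \sum_(k <- divisors n | (k < n)%N)
     f k * g (n %/ k)%N * (ln ((n %/ k)%:R : R))%:C.

(* X(Y), for Y a subspace of H2 w *)
Definition volterra_symbols (R : realType) (w : nat -> R)
    (Y : set (dseries R)) : set (dseries R) :=
  [set g | class_D g /\
     exists M : R, forall f, Y f ->
       Y (volterra g f) /\ H2_norm w (volterra g f) <= M * H2_norm w f].

Definition dmul (R : realType) (f h : dseries R) : dseries R := fun n =>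
  \sum_(k <- divisors n) f k * h (n %/ k)%N.

Definition dirichlet_polynomial (R : realType) (F : dseries R) : Prop :=
  exists N, forall n, (N < n)%N -> F n = 0.

(* The values of sum_k ||f_k|| ||h_k|| over all finite representations
   F = sum_k f_k h_k with f_k, h_k in Y. *)
Definition weak_product_costs (R : realType) (w : nat -> R)
    (Y : set (dseries R)) (F : dseries R) : set R :=
  [set c | exists (m : nat) (f h : 'I_m -> dseries R),
     [/\ forall k, Y (f k) /\ Y (h k),
         forall n, (0 < n)%N -> F n = \sum_(k < m) dmul (f k) (h k) n
       & c = \sum_(k < m) H2_norm w (f k) * H2_norm w (h k)]].

(* Only meaningful when F has a finite representation, i.e. when the set of
   costs is nonempty. *)
Definition weak_product_norm (R : realType) (w : nat -> R)
    (Y : set (dseries R)) (F : dseries R) : R :=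
  inf (weak_product_costs w Y F).

(* (Y . Y)^* in the H2 w pairing, for Y = H2 w or H2_0 w: the phi for which
   F |-> <F, phi> is bounded on the Dirichlet polynomials of the weak product.
   Those polynomials are exactly the ones with a finite representation, so the
   completion does not have to be formed: for H2 w, F = F * 1; for H2_0 w,
   elements of the completion have zero coefficients at 1 and at the primes
   (these coefficients are continuous), and every composite n splits as k * l
   with k, l > 1. *)
Definition weak_product_dual (R : realType) (w : nat -> R)
    (Y : set (dseries R)) : set (dseries R) :=
  [set phi | class_D phi /\
     exists M : R, forall F,
       dirichlet_polynomial F -> weak_product_costs w Y F !=set0 ->
       ComplexField.Normc.normc (H2_inner w F phi)
         <= M * weak_product_norm w Y F].

(* Main.v *)
Require Import Defs.
From mathcomp Require Import all_boot all_order all_algebra.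
From mathcomp Require Import all_classical all_reals all_analysis.
From mathcomp Require Import complex zify ring lra.

Set Implicit Arguments.
Unset Strict Implicit.
Unset Printing Implicit Defensive.

Import Order.TTheory GRing.Theory Num.Theory.
Import numFieldNormedType.Exports.

Local Open Scope classical_set_scope.
Local Open Scope ring_scope.
Local Open Scope complex_scope.

(** Let L multiply the n-th coefficient by log n, a derivation for the product
    of Dirichlet series, and put v_n = 1 / (w_n log^2 n) for n > 1. Then
    T_g h is L^-1 (h . Lg), so the norm of T_g h in H2_w is the norm of h . Lg
    with the weights v, and by the Leibniz rule

      <f h, g>_w = f_1 h_1 conj(g_1) + <Lf . h, Lg>_v + <f . Lh, Lg>_v .

    Inclusion. Each of the last two terms is controlled by T_g as soon as
    |<a h, G>_v| <= |a|_v |h G|_v, for then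
    |<Lf . h, Lg>_v| <= |Lf|_v |h . Lg|_v <= |f| |T_g h|. For v = 1 this is
    Cauchy-Schwarz on the Bohr torus, where |conj(h) G| = |h G|
    ([correlation_le_convolution]). The squared form of the inequality
    ([hyponormal]) is linear in v and survives multiplication of v by a
    completely multiplicative function with nonnegative values, hence by sums
    and limits of such functions. Both factors of v are of this kind: 1 / log^2 n
    is a Laplace transform of the functions n^-d, and 1 / w_n is a product over
    the primes p of (k + 1)^-beta or of the inverse of a rising binomial
    coefficient, k being the exponent of p in n; these are moment sequences,
    that is, mixtures of the functions r^k ([hypo_mult_powRN],
    [hypo_seq_rising_binom]). For the weights defined by zeta^(beta + 1) this
    requires the Euler product and the uniqueness of Dirichlet coefficients
    ([zeta_power_series], [dirichlet_unique]).

    The argument bounds <f h, g> for Dirichlet polynomials f and h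
    ([hankel_polynomial]), whereas a Dirichlet polynomial F may be written as
    sum_k f_k h_k with infinite series f_k and h_k whose tails cancel. Let
    A(n) be the sum of the prime factors of n with multiplicity. It is
    completely additive, takes each value finitely often, and the Fejer mean
    sum_n (1 - A(n)/D)_+ (f h)_n of a product is the average over x < D of
    products of truncations of f to A <= x and of h to A < D - x
    ([fejer_mean]). Letting D grow gives the bound for F ([hankel_extends]).

    Strictness. Let ell = sum_i (i + 1)^(-3/4) p_i^-s, where p_0 < p_1 < ... are
    the primes, and phi = ell^8. All integers in the support of phi have eight
    prime factors, so at most 2^8 divisors, and phi is square summable;
    Cauchy-Schwarz then makes its Hankel form bounded ([homogeneous_dual]). On
    the other hand the k-th iterate of T_phi maps phi to
    ell^(8 (k + 1)) / (k + 1)! ([volterra_octic_power]), while the coefficient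
    of ell^(8 k) at the product of the first 8 k primes is
    (8 k)!^(1/4) >= k!^2 ([octic_growth]). A bounded T_phi would force k! to
    grow at most exponentially ([octic_not_symbol]).

    The two spaces are treated together: only the properties [admissible] of
    the subspace are used. *)

(** * Finite sums and divisibility *)

Lemma ler_sum_inj (R : numDomainType) (I J : eqType) (s : seq I) (T : seq J)
    (h : I -> J) (f : J -> R) :
  uniq s -> uniq T -> {in s, forall i, h i \in T} -> {in s &, injective h} ->
  {in T, forall j, 0 <= f j} ->
  \sum_(i <- s) f (h i) <= \sum_(j <- T) f j.
Proof.
move=> us uT hT hinj f0.
rewrite -(big_map h predT f) [leRHS](bigID (fun j => j \in map h s)) /=.
rewrite -[leLHS]addr0 lerD //; last first.
  by rewrite big_seq_cond sumr_ge0 // => j /andP[/f0].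
rewrite le_eqVlt; apply/orP; left; apply/eqP; rewrite -[RHS]big_filter.
apply: perm_big; apply: uniq_perm; rewrite ?filter_uniq ?map_inj_in_uniq //.
move=> j; rewrite mem_filter andb_idr //.
by move=> /mapP[i /hT hi ->].
Qed.

Lemma prime_ind (P : nat -> Prop) : P 1%N ->
  (forall p n, prime p -> (0 < n)%N -> P n -> P (p * n)%N) ->
  forall n, (0 < n)%N -> P n.
Proof.
move=> P1 PM; elim/ltn_ind => n IH n0.
have [n1|n1] := leqP n 1.
  by have -> : n = 1%N by apply/eqP; rewrite eqn_leq n1 n0.
have pp := pdiv_prime n1; have := pdiv_dvd n; move: (pdiv n) pp => p pp /dvdnP[q E].
have q0 : (0 < q)%N by move: n0; rewrite E muln_gt0 => /andP[].
by rewrite E mulnC; apply: PM => //; apply: IH => //; rewrite E ltn_Pmulr ?prime_gt1.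
Qed.

(** * Squared moduli *)

Section Modulus.
Variable R : realType.
Implicit Types z w : R[i].

Definition sqmod z : R := ComplexField.Normc.normc z ^+ 2.

Lemma sqmodE z : sqmod z = complex.Re z ^+ 2 + complex.Im z ^+ 2.
Proof.
by case: z => a b; rewrite /sqmod /= sqr_sqrtr // addr_ge0 ?sqr_ge0.
Qed.

Lemma sqmodJ z : (sqmod z)%:C = z * (Num.conj z : R[i]).
Proof.
rewrite sqmodE; case: z => a b /=; apply/eqP; rewrite eq_complex /=.
by apply/andP; split; apply/eqP; ring.
Qed.

Lemma sqmod_ge0 z : 0 <= sqmod z.
Proof. exact: sqr_ge0. Qed.

Lemma sqmodM z w : sqmod (z * w) = sqmod z * sqmod w.
Proof. by rewrite /sqmod ComplexField.Normc.normcM exprMn. Qed.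

Lemma sqmod_conj z : sqmod (Num.conj z : R[i]) = sqmod z.
Proof. by rewrite !sqmodE; case: z => a b /=; rewrite sqrrN. Qed.

Lemma sqmod0 : sqmod 0 = 0.
Proof. by rewrite sqmodE /= expr0n /= addr0. Qed.

Lemma sqmod_real (x : R) : sqmod x%:C = x ^+ 2.
Proof. by rewrite sqmodE /= expr0n addr0. Qed.

Lemma Re_sqmod z : complex.Re (z * (Num.conj z : R[i])) = sqmod z.
Proof. by rewrite -sqmodJ. Qed.

Lemma conj_real (x : R) : Num.conj (x%:C : R[i]) = x%:C :> R[i].
Proof. exact: conjc_real. Qed.

Lemma real_complexM (x y : R) : (x * y)%:C = x%:C * y%:C :> R[i].
Proof. exact: rmorphM. Qed.

Lemma conjM z w : Num.conj (z * w : R[i]) = (Num.conj z : R[i]) * Num.conj w :> R[i].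
Proof. exact: rmorphM. Qed.

Lemma ReD z w : complex.Re (z + w) = complex.Re z + complex.Re w.
Proof. by case: z; case: w. Qed.

Lemma ReZ (x : R) z : complex.Re (z * x%:C) = complex.Re z * x.
Proof. by case: z => a b /=; ring. Qed.

Lemma Re_sum (I : Type) (s : seq I) (P : pred I) (F : I -> R[i]) :
  complex.Re (\sum_(i <- s | P i) F i) = \sum_(i <- s | P i) complex.Re (F i).
Proof. by apply: (big_morph _ ReD). Qed.

Lemma Re_prod_le z w : 2 * complex.Re (z * w) <= sqmod z + sqmod w.
Proof.
rewrite !sqmodE; case: z => a b; case: w => c d /=.
rewrite -subr_ge0.
have -> : a ^+ 2 + b ^+ 2 + (c ^+ 2 + d ^+ 2) - 2 * (a * c - b * d)
   = (a - c) ^+ 2 + (b + d) ^+ 2 by ring.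
by rewrite addr_ge0 ?sqr_ge0.
Qed.

End Modulus.

(** * Hyponormal weights *)

Section Hyponormal.
Variable R : realType.
Local Notation C := R[i].

(** Expanding the squares leaves the products over pairs lying in a common fiber
    of r, so that identities between two such sums become relabellings. *)
Lemma sum_sqmod_fibers (B T : nat) (r : nat -> nat -> nat) (c : nat -> nat -> C) :
  (forall k l, (0 < k < B)%N -> (0 < l < B)%N -> (0 < r k l < T)%N) ->
  \sum_(1 <= t < T)
    (sqmod (\sum_(1 <= k < B) \sum_(1 <= l < B | r k l == t) c k l))%:C =
  \sum_(1 <= k < B) \sum_(1 <= l < B)
    \sum_(1 <= k' < B) \sum_(1 <= l' < B | r k' l' == r k l)
      c k l * Num.conj (c k' l').
Proof.
move=> hr.
under eq_bigr => t _.
  rewrite sqmodJ mulr_suml.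
  under eq_bigr => k _.
    rewrite mulr_suml big_mkcond.
    over.
  over.
rewrite exchange_big_nat; apply: eq_big_nat => k hk.
rewrite exchange_big_nat; apply: eq_big_nat => l hl.
rewrite -big_mkcond /=.
transitivity (\sum_(1 <= t < T | t == r k l) c k l *
    (\sum_(1 <= k' < B) \sum_(1 <= l' < B | r k' l' == t) c k' l')^*).
  by apply: eq_bigl => t; rewrite eq_sym.
rewrite big_nat1_eq hr // rmorph_sum mulr_sumr.
apply: eq_bigr => k' _; rewrite rmorph_sum mulr_sumr.
by apply: eq_bigr => l' _.
Qed.

(** The inequality 2 Re <a h, G>_V <= |a|_V^2 + |h G|_V^2 for finitely supported
    sequences. In this form, rather than as a product of two norms, it is linear
    in V. The vanishing of a_1 and G_1 makes V_1 irrelevant, as it must be for a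
    weight like 1 / log^2 n. *)
Definition hyponormal (V : nat -> R) : Prop :=
  forall (B : nat) (a h G : nat -> C), a 1%N = 0 -> G 1%N = 0 ->
  2 * complex.Re (\sum_(1 <= j < B) \sum_(1 <= k < B)
         \sum_(1 <= l < B | (j * k == l)%N) a j * h k * Num.conj (G l) * (V l)%:C)
  <= \sum_(1 <= j < B) V j * sqmod (a j) +
     \sum_(1 <= n < B ^ 2)
        V n * sqmod (\sum_(1 <= k < B) \sum_(1 <= l < B | (k * l == n)%N)
                       h k * G l).

(** The left side runs over the integral ratios j = l / k, and extending it to
    all rational ratios gives sum of h_k conj(G_l) conj(h_k') G_l' over
    l / k = l' / k'. Exchanging l and l' turns the condition into
    k l = k' l', that is, into the right side. *)
Lemma correlation_le_convolution (B : nat) (h G : nat -> C) :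
  \sum_(1 <= j < B)
     sqmod (\sum_(1 <= k < B) \sum_(1 <= l < B | (j * k == l)%N) h k * Num.conj (G l))
  <= \sum_(1 <= n < B ^ 2)
        sqmod (\sum_(1 <= k < B) \sum_(1 <= l < B | (k * l == n)%N)
                       h k * G l).
Proof.
(* The common denominator M replaces the ratios l / k by the integers r k l. *)
pose M := (B`!)%N.
have M0 : (0 < M)%N by rewrite fact_gt0.
have dM k : (0 < k < B)%N -> (k %| M)%N.
  by move=> /andP[k0 kB]; rewrite dvdn_fact // k0 ltnW.
pose r k l := (l * (M %/ k))%N.
have rE k l k' l' : (0 < k < B)%N -> (0 < k' < B)%N ->
    (r k l == r k' l') = (l * k' == l' * k)%N.
  move=> hk hk'; have /andP[k0 _] := hk; have /andP[k'0 _] := hk'.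
  rewrite /r -(@eqn_pmul2r (k * k')) ?muln_gt0 ?k0 //.
  have -> : (l * (M %/ k) * (k * k') = (l * k') * (M %/ k * k))%N by lia.
  have -> : (l' * (M %/ k') * (k * k') = (l' * k) * (M %/ k' * k'))%N by lia.
  by rewrite !divnK ?dM // eqn_pmul2r.
pose T := (B * M).+1.
have hr k l : (0 < k < B)%N -> (0 < l < B)%N -> (0 < r k l < T)%N.
  move=> hk hl; have /andP[k0 kB] := hk; have /andP[l0 lB] := hl.
  rewrite /r muln_gt0 l0 divn_gt0 // dvdn_leq ?dM //= ltnS leq_mul ?(ltnW lB) //.
  by rewrite leq_div.
(* The values j * M of r are those of the pairs (k, l) with l = j * k. *)
apply: (@le_trans _ _ (\sum_(1 <= t < T)
    sqmod (\sum_(1 <= k < B) \sum_(1 <= l < B | r k l == t) h k * Num.conj (G l)))).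
  rewrite (eq_big_nat _ _ (F2 := fun j => sqmod
    (\sum_(1 <= k < B) \sum_(1 <= l < B | r k l == (j * M)%N) h k * Num.conj (G l)))).
    apply: (@ler_sum_inj _ _ _ _ _ (fun j => j * M)%N (fun t => sqmod
      (\sum_(1 <= k < B) \sum_(1 <= l < B | r k l == t) h k * Num.conj (G l)))).
    - exact: iota_uniq.
    - exact: iota_uniq.
    - move=> j; rewrite !mem_index_iota => /andP[j0 jB].
      by rewrite muln_gt0 j0 M0 ltnS leq_mul // ltnW.
    - by move=> x y _ _ /eqP; rewrite eqn_pmul2r // => /eqP.
    - by move=> t _; exact: sqmod_ge0.
  move=> j hj; congr sqmod.
  apply: eq_big_nat => k hk; apply: eq_bigl => l.
  have /andP[k0 _] := hk.
  rewrite /r -[(_ * _ == j * M)%N](@eqn_pmul2r k) // -mulnA divnK ?dM //.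
  by rewrite mulnAC eqn_pmul2r // eq_sym.
have hp k l : (0 < k < B)%N -> (0 < l < B)%N -> (0 < k * l < B ^ 2)%N.
  by move=> /andP[k0 kB] /andP[l0 lB]; rewrite muln_gt0 k0 l0 expnS expn1 ltn_mul.
rewrite le_eqVlt; apply/orP; left; apply/eqP.
apply: complexI; rewrite !rmorph_sum /= (sum_sqmod_fibers _ hr) (sum_sqmod_fibers _ hp).
apply: eq_big_nat => k hk.
transitivity (\sum_(1 <= k' < B) \sum_(1 <= l < B) \sum_(1 <= l' < B | r k' l' == r k l)
   h k * Num.conj (G l) * (h k' * (Num.conj (G l')))^*); first by rewrite exchange_big_nat.
rewrite [RHS]exchange_big_nat; apply: eq_big_nat => k' hk'.
under eq_bigr => l _ do rewrite big_mkcond /=.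
rewrite exchange_big_nat /=.
apply: eq_big_nat => l hl; rewrite big_mkcond.
apply: eq_big_nat => l' hl'; rewrite rE //.
have -> : (l' * k == l * k')%N = (k' * l == k * l')%N.
  by rewrite eq_sym mulnC [(l' * k)%N]mulnC.
rewrite !rmorphM /= !conjCK.
case: ifP => // _; ring.
Qed.

Lemma hyponormal1 : hyponormal (fun=> 1).
Proof.
move=> B a h G a1 G1.
rewrite (eq_bigr (fun j => sqmod (a j))); last by move=> *; rewrite mul1r.
rewrite [X in _ <= _ + X](eq_bigr (fun n => sqmod
   (\sum_(1 <= k < B) \sum_(1 <= l < B | (k * l == n)%N) h k * G l)));
  last by move=> *; rewrite mul1r.
apply: le_trans (lerD (lexx _) (correlation_le_convolution B h G)).
rewrite -big_split Re_sum mulr_sumr; apply: ler_sum => j _ /=.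
apply: le_trans (Re_prod_le _ _); rewrite le_eqVlt; apply/orP; left; apply/eqP.
congr (2 * complex.Re _); rewrite mulr_sumr; apply: eq_bigr => k _.
by rewrite mulr_sumr; apply: eq_bigr => l _; rewrite mulr1 mulrA.
Qed.

End Hyponormal.

(** * Multipliers of hyponormal weights *)

Section Multipliers.
Variable R : realType.
Local Notation C := R[i].
Implicit Types (V v : nat -> R).

(** For fixed a, h and G the inequality reads as the nonnegativity of a linear
    form in V; its coefficient at 1 vanishes because a and G vanish there. *)
Lemma hyponormal_linear (B : nat) (a h G : nat -> C) :
  a 1%N = 0 -> G 1%N = 0 ->
  exists2 c : nat -> R, c 1%N = 0 & forall V,
  (2 * complex.Re (\sum_(1 <= j < B) \sum_(1 <= k < B)
         \sum_(1 <= l < B | (j * k == l)%N) a j * h k * (Num.conj (G l)) * (V l)%:C)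
  <= \sum_(1 <= j < B) V j * sqmod (a j) +
     \sum_(1 <= n < B ^ 2)
        V n * sqmod (\sum_(1 <= k < B) \sum_(1 <= l < B | (k * l == n)%N)
                       h k * G l))
  = (0 <= \sum_(1 <= n < B ^ 2) c n * V n).
Proof.
move=> a1 G1.
have leB : (B <= B ^ 2)%N by rewrite expnS expn1; case: (B) => // b; rewrite leq_pmulr.
exists (fun n => (if (n < B)%N then sqmod (a n) else 0)
  + sqmod (\sum_(1 <= k < B) \sum_(1 <= l < B | (k * l == n)%N) h k * G l)
  - 2 * (if (n < B)%N then complex.Re (\sum_(1 <= j < B) \sum_(1 <= k < B | (j * k == n)%N)
      a j * h k * (Num.conj (G n))) else 0)).
  rewrite a1 sqmod0 if_same add0r [X in sqmod X]big1_seq ?sqmod0; last first.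
    move=> k _; apply: big1_seq => l /andP[+ _].
    by rewrite muln_eq1 => /andP[_ /eqP ->]; rewrite G1 mulr0.
  rewrite G1 big1_seq ?if_same ?mulr0 ?subr0 //= => j _.
  by apply: big1_seq => k _; rewrite rmorph0 mulr0.
move=> V.
have E : complex.Re (\sum_(1 <= j < B) \sum_(1 <= k < B)
         \sum_(1 <= l < B | (j * k == l)%N) a j * h k * (Num.conj (G l)) * (V l)%:C)
  = \sum_(1 <= n < B) complex.Re (\sum_(1 <= j < B) \sum_(1 <= k < B | (j * k == n)%N)
      a j * h k * (Num.conj (G n))) * V n.
  under [RHS]eq_bigr => n _.
    rewrite -ReZ mulr_suml.
    under eq_bigr => j _ do rewrite mulr_suml big_mkcond.
    over.
  rewrite -Re_sum; congr complex.Re; rewrite [RHS]exchange_big_nat.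
  apply: eq_bigr => j _; rewrite [RHS]exchange_big_nat; apply: eq_bigr => k _.
  by rewrite [LHS]big_mkcond.
rewrite -subr_ge0; congr (0 <= _).
rewrite E (big_nat_widen _ _ _ _ _ leB) big_mkcond /=.
rewrite [X in 2 * X](big_nat_widen _ _ _ _ _ leB) [X in 2 * X]big_mkcond /=.
rewrite mulr_sumr -big_split -sumrB; apply: eq_bigr => n _ /=.
by case: ifP => _; ring.
Qed.

Lemma hyponormal_ext V V' :
  (forall n, (1 < n)%N -> V n = V' n) -> hyponormal V -> hyponormal V'.
Proof.
move=> e hV B a h G a1 G1; have [c c1 cE] := hyponormal_linear B h a1 G1.
have := hV B a h G a1 G1; rewrite !cE.
rewrite (_ : \sum_(1 <= n < B ^ 2) c n * V n = \sum_(1 <= n < B ^ 2) c n * V' n) //.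
apply: eq_big_nat => n /andP[n0 _].
have [->|n1] := eqVneq n 1%N; first by rewrite c1 !mul0r.
by rewrite e //; move: n0 n1; lia.
Qed.

(** Multipliers, instead of hyponormal weights themselves, because they are
    closed under products. *)
Definition hypo_mult v : Prop :=
  forall V, hyponormal V -> hyponormal (fun n => v n * V n).

Lemma hypo_mult_ext v v' :
  (forall n, (1 < n)%N -> v n = v' n) -> hypo_mult v -> hypo_mult v'.
Proof.
by move=> e hv V hV; apply: hyponormal_ext (hv V hV) => n n1; rewrite e.
Qed.

Lemma hypo_mult_mul v v' :
  hypo_mult v -> hypo_mult v' -> hypo_mult (fun n => v n * v' n).
Proof.
move=> hv hv' V hV; apply: hyponormal_ext (hv _ (hv' _ hV)) => n _.
by rewrite mulrA.
Qed.

Lemma hypo_mult_add v v' :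
  hypo_mult v -> hypo_mult v' -> hypo_mult (fun n => v n + v' n).
Proof.
move=> hv hv' V hV B a h G a1 G1; have [c _ cE] := hyponormal_linear B h a1 G1.
have := hv _ hV B a h G a1 G1; have := hv' _ hV B a h G a1 G1.
rewrite !cE => h1 h2; apply: le_trans (addr_ge0 h1 h2) _.
rewrite -big_split /= le_eqVlt; apply/orP; left; apply/eqP.
by apply: eq_bigr => n _; ring.
Qed.

Lemma hypo_mult_cst (x : R) : 0 <= x -> hypo_mult (fun=> x).
Proof.
move=> x0 V hV B a h G a1 G1; have [c _ cE] := hyponormal_linear B h a1 G1.
have := hV B a h G a1 G1; rewrite !cE => h1.
apply: le_trans (mulr_ge0 x0 h1) _.
rewrite mulr_sumr /= le_eqVlt; apply/orP; left; apply/eqP.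
by apply: eq_bigr => n _; ring.
Qed.

Lemma hypo_mult_sum (I : Type) (s : seq I) (P : pred I) (v : I -> nat -> R) :
  (forall i, P i -> hypo_mult (v i)) ->
  hypo_mult (fun n => \sum_(i <- s | P i) v i n).
Proof.
move=> hv; elim: s => [|i s IH].
  by apply: hypo_mult_ext (hypo_mult_cst (lexx 0)) => n _; rewrite big_nil.
have [Pi|nPi] := boolP (P i).
  apply: hypo_mult_ext (hypo_mult_add (hv i Pi) IH) => n _.
  by rewrite big_cons Pi.
by apply: hypo_mult_ext IH => n _; rewrite big_cons (negbTE nPi).
Qed.

Lemma hypo_mult_prod (I : Type) (s : seq I) (P : pred I) (v : I -> nat -> R) :
  (forall i, P i -> hypo_mult (v i)) ->
  hypo_mult (fun n => \prod_(i <- s | P i) v i n).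
Proof.
move=> hv; elim: s => [|i s IH].
  by apply: hypo_mult_ext (hypo_mult_cst ler01) => n _; rewrite big_nil.
have [Pi|nPi] := boolP (P i).
  apply: hypo_mult_ext (hypo_mult_mul (hv i Pi) IH) => n _.
  by rewrite big_cons Pi.
by apply: hypo_mult_ext IH => n _; rewrite big_cons (negbTE nPi).
Qed.

Lemma hypo_mult_lim (u : nat -> nat -> R) v :
  (forall i, hypo_mult (u i)) ->
  (forall n, (1 < n)%N -> u ^~ n @ \oo --> v n) -> hypo_mult v.
Proof.
move=> hu uv V hV B a h G a1 G1; have [c c1 cE] := hyponormal_linear B h a1 G1.
rewrite cE.
have lim : (fun i => \sum_(1 <= n < B ^ 2) c n * (u i n * V n)) @ \oo -->
           \sum_(1 <= n < B ^ 2) c n * (v n * V n).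
  rewrite big_seq; under eq_fun do rewrite big_seq.
  apply: cvg_big; first exact: add_continuous.
  move=> n; rewrite mem_index_iota => /andP[n0 _].
  have [->|n1] := eqVneq n 1%N.
    by rewrite c1 mul0r; under eq_fun do rewrite mul0r; exact: cvg_cst.
  by apply: cvgMr; apply: cvgMl; apply: uv; move: n0 n1; lia.
rewrite -(cvg_lim _ lim) //; apply: limr_ge.
  by apply/cvg_ex; eexists; exact: lim.
by apply: nearW => i; have := hu i _ hV B a h G a1 G1; rewrite cE.
Qed.

(** If l = j k then chi_l is the product of the square roots of chi_j, chi_k and
    chi_l, which can be absorbed in a, h and G. *)
Lemma hypo_mult_completely_multiplicative (chi : nat -> R) :
  (forall n, 0 <= chi n) ->
  (forall m n, (0 < m)%N -> (0 < n)%N -> chi (m * n)%N = chi m * chi n) ->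
  hypo_mult chi.
Proof.
move=> chi0 chiM V hV B a h G a1 G1.
pose t n : C := (Num.sqrt (chi n))%:C.
have tt n : sqmod (t n) = chi n by rewrite sqmod_real sqr_sqrtr.
have t2 n : t n * t n = (chi n)%:C.
  by rewrite -real_complexM -expr2 sqr_sqrtr.
have tJ n : (Num.conj (t n)) = t n by exact: conj_real.
have tM m n : (0 < m)%N -> (0 < n)%N -> t (m * n)%N = t m * t n.
  by move=> m0 n0; rewrite /t chiM // sqrtrM // real_complexM.
have := hV B (fun j => a j * t j) (fun k => h k * t k) (fun l => G l * t l).
rewrite a1 G1 !mul0r => /(_ erefl erefl); congr (_ <= _).
  congr (2 * complex.Re _); apply: eq_big_nat => j /andP[j0 _].
  apply: eq_big_nat => k /andP[k0 _]; apply: eq_bigr => l /eqP <-.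
  have -> : (chi (j * k)%N * V (j * k)%N)%:C
     = t j * t j * (t k * t k) * (V (j * k)%N)%:C.
    by rewrite !t2 chiM // -!real_complexM.
  by rewrite conjM tJ tM //; ring.
congr (_ + _).
  by apply: eq_bigr => j _; rewrite sqmodM tt; ring.
apply: eq_bigr => n _; rewrite -[in RHS](tt n) [_ * V n]mulrC -mulrA -sqmodM.
congr (_ * sqmod _); rewrite mulr_sumr; apply: eq_big_nat => k /andP[k0 _].
rewrite big_mkcond [in RHS]big_mkcond mulr_sumr; apply: eq_big_nat => l /andP[l0 _].
case: eqP => [<-|_]; last by rewrite mulr0.
by rewrite tM //; ring.
Qed.

End Multipliers.

(** * The binomial series *)

Section BinomialSeries.
Variable R : realType.
Variable g : R.
Hypothesis g0 : 0 < g.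

(** The coefficient of z^k in (1 - z)^-gam. *)
Definition rising_binom (gam : R) (k : nat) : R :=
  \prod_(i < k) ((gam + i%:R) / i.+1%:R).
Local Notation b := (rising_binom g).

Lemma rising_binomS gam k :
  k.+1%:R * rising_binom gam k.+1 = (gam + k%:R) * rising_binom gam k.
Proof.
rewrite /rising_binom big_ord_recr /=; set P := \prod_(_ < _) _.
have : k.+1%:R != 0 :> R by rewrite pnatr_eq0.
by set x := k.+1%:R => x0; field.
Qed.

Lemma rising_binom_ge0 gam k : 0 <= gam -> 0 <= rising_binom gam k.
Proof. by move=> h; rewrite prodr_ge0 // => i _; rewrite divr_ge0 ?addr_ge0. Qed.

Let damped_sum K (x : R) := (1 - x) `^ g * \sum_(k < K) b k * x ^+ k.

(** In the derivative of (1 - x)^g times the K-th partial sum of the series of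
    (1 - x)^-g everything cancels except the last term. *)
Lemma is_derive_damped_sum K (z : R) : z < 1 ->
  is_derive z 1 (damped_sum K) (- (K%:R * b K * z ^+ K.-1 * (1 - z) `^ (g - 1))).
Proof.
move=> z1; have z1' : 0 < 1 - z by rewrite subr_gt0.
elim: K => [|K IH].
  rewrite !mul0r oppr0.
  have -> : damped_sum 0 = cst 0 by apply/funext => x; rewrite /damped_sum big_ord0 mulr0.
  exact: is_derive_cst.
have -> : damped_sum K.+1 = damped_sum K + (fun x => (1 - x) `^ g) * (fun x => b K * x ^+ K).
  by apply/funext => x; rewrite fctE /damped_sum big_ord_recr /= mulrDr.
have d0 : is_derive z 1 (fun x : R => 1 - x) (-1).
  rewrite -[-1]sub0r.
  exact: (is_deriveB (is_derive_cst (1 : R) z 1) (is_derive_id z 1)).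
have d1 : is_derive z 1 (fun x => (1 - x) `^ g) (g * (1 - z) `^ (g - 1) * -1).
  exact: (@is_derive1_comp _ (fun x => x `^ g) (fun x => 1 - x) _ _ _ (is_derive1_powR g z1') d0).
have d2 : is_derive z 1 (fun x => b K * x ^+ K) (b K * (K%:R * z ^+ K.-1)).
  have := is_deriveZ (b K) (is_deriveX K (is_derive_id z 1)).
  rewrite /GRing.scale /= mulr1.
  have -> // : b K \*: (id ^+ K) = (fun x => b K * x ^+ K).
  by apply/funext => x /=; rewrite fctE.
have := is_deriveM d1 d2; have := is_deriveD IH.
move=> /[apply] h; apply: is_derive_eq h _.
rewrite rising_binomS /= /GRing.scale /=.
have -> : (1 - z) `^ g = (1 - z) * (1 - z) `^ (g - 1).
  by rewrite mulr_powRB1 // ltW.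
case: (K) => [|k] /=; first by rewrite !expr0; ring.
by rewrite exprS; ring.
Qed.

Lemma damped_sum_bounds K (z : R) : 0 < z < 1 -> (0 < K)%N ->
  1 - K%:R * b K * z ^+ K / (1 - z) <= damped_sum K z <= 1.
Proof.
move=> /andP[z0 z1] K0.
have b0 : 0 <= K%:R * b K by rewrite mulr_ge0 ?rising_binom_ge0 // ltW.
have damped_sum0 : damped_sum K 0 = 1.
  rewrite /damped_sum subr0 powR1 mul1r; case: K K0 {b0} => // k _.
  rewrite big_ord_recl big1 ?addr0.
    by rewrite /rising_binom big_ord0 expr0 mulr1.
  by move=> i _; rewrite expr0n mulr0.
have [|c|c] := @MVT _ (damped_sum K) (fun x => - (K%:R * b K * x ^+ K.-1 * (1 - x) `^ (g - 1))) 0 z z0.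
- by move=> x; rewrite in_itv /= => /andP[_ xz]; apply: is_derive_damped_sum; apply: lt_trans z1.
- apply: derivable_within_continuous => x; rewrite in_itv /= => /andP[_ xz].
  by have [] := is_derive_damped_sum K (le_lt_trans xz z1).
rewrite in_itv /= damped_sum0 subr0 => /andP[c0 cz] E.
have -> : damped_sum K z = 1 - K%:R * b K * c ^+ K.-1 * (1 - c) `^ (g - 1) * z.
  by rewrite -[LHS](subrK 1) E; ring.
have c1 : c < 1 by apply: lt_trans z1.
apply/andP; split; last first.
  by rewrite lerBlDr lerDl !mulr_ge0 ?rising_binom_ge0 ?powR_ge0 ?exprn_ge0 // ltW.
rewrite lerD2l lerN2.
have -> : K%:R * b K * z ^+ K / (1 - z) = K%:R * b K * z ^+ K.-1 * (1 - z)^-1 * z.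
  by case: K K0 {b0 damped_sum0 E} => // k _; rewrite exprSr /=; ring.
have c1' : 0 < 1 - c by rewrite subr_gt0.
have A : K%:R * b K * c ^+ K.-1 <= K%:R * b K * z ^+ K.-1.
  by apply: ler_wpM2l => //; rewrite lerXn2r ?nnegrE ?ltW.
have A0 : 0 <= K%:R * b K * c ^+ K.-1.
  by apply: mulr_ge0 => //; rewrite exprn_ge0 // ltW.
have D : (1 - c) `^ (g - 1) <= (1 - z)^-1.
  apply: (@le_trans _ _ ((1 - c) `^ (-1))).
    apply: ger_powR; last by rewrite lerBrDl subrr ltW.
    by rewrite c1' lerBlDr lerDl ltW.
  rewrite powR_inv1 ?(ltW c1') // lef_pV2 ?posrE ?subr_gt0 //.
  by rewrite lerD2l lerN2 ltW.
by rewrite ler_wpM2r ?(ltW z0) //; apply: ler_pM => //; exact: powR_ge0.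
Qed.

(** Applied at y = sqrt z, the bound [damped_sum_bounds] makes b_K y^K bounded, and
    K y^K tends to 0. *)
Lemma rising_binom_tail (z : R) : 0 < z < 1 ->
  (fun K => K%:R * b K * z ^+ K) @ \oo --> 0.
Proof.
(* With x = z^(1/4), Bernoulli's inequality for 1 / x bounds K y^K = K x^(2 K)
   by a multiple of x^K. *)
move=> /andP[z0 z1]; pose y := Num.sqrt z.
have y0 : 0 < y by rewrite sqrtr_gt0.
have y1 : y < 1 by rewrite -[X in _ < X]sqrtr1 ltr_sqrt.
have yz : z = y * y by rewrite -expr2 sqr_sqrtr ?ltW.
pose x := Num.sqrt y.
have x0 : 0 < x by rewrite sqrtr_gt0.
have x1 : x < 1 by rewrite -[X in _ < X]sqrtr1 ltr_sqrt.
have xy : y = x * x by rewrite -expr2 sqr_sqrtr ?ltW.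
pose D := ((1 - y) `^ g)^-1.
have bD K : b K * y ^+ K <= D.
  have := damped_sum_bounds (K := K.+1) (z := y); rewrite y0 y1 => /(_ erefl erefl) /andP[_].
  have p0 : 0 < (1 - y) `^ g by rewrite powR_gt0 // subr_gt0.
  rewrite /damped_sum -ler_pdivlMl // mulr1; apply: le_trans.
  rewrite big_ord_recr /= lerDr sumr_ge0 // => i _.
  by rewrite mulr_ge0 ?rising_binom_ge0 ?exprn_ge0 // ltW.
have D0 : 0 <= D by rewrite invr_ge0 powR_ge0.
have bern K : K%:R * y ^+ K <= (x^-1 - 1)^-1 * x ^+ K.
  have e0 : 0 < x^-1 - 1 by rewrite subr_gt0 invf_gt1.
  have : 1 + (x^-1 - 1) *+ K <= x^-1 ^+ K.
    elim: K => [|K IH]; first by rewrite mulr0n expr0 addr0.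
    rewrite exprS mulrS; apply: le_trans (ler_wpM2l _ IH); last by rewrite invr_ge0 ltW.
    have := mulr_ge0 (ltW e0) (mulrn_wge0 K (ltW e0)).
    rewrite -mulr_natr; nra.
  rewrite exprVn xy exprMn; have := exprn_gt0 K x0; set p := x ^+ K => p0 h.
  rewrite mulrA ler_wpM2r ?(ltW p0) // -[leRHS]mul1r ler_pdivlMr //.
  have : (1 + (x^-1 - 1) *+ K) * p <= 1 by rewrite -ler_pdivlMr // div1r.
  rewrite -mulr_natr; lra.
have lim : (fun K => D * ((x^-1 - 1)^-1 * x ^+ K)) @ \oo --> 0.
  rewrite -[X in _ --> X](mulr0 D); apply: cvgMr.
  by apply: cvg_geometric; rewrite gtr0_norm.
apply: squeeze_cvgr (cvg_cst 0) lim; apply: nearW => K; apply/andP; split.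
  by rewrite !mulr_ge0 ?rising_binom_ge0 ?exprn_ge0 // ltW.
rewrite yz exprMn.
have -> : K%:R * b K * (y ^+ K * y ^+ K) = b K * y ^+ K * (K%:R * y ^+ K) by ring.
by rewrite ler_pM // mulr_ge0 ?rising_binom_ge0 ?exprn_ge0 // ltW.
Qed.

Lemma rising_binom_series (z : R) : 0 < z < 1 ->
  (fun K => \sum_(k < K) b k * z ^+ k) @ \oo --> (1 - z) `^ (- g).
Proof.
move=> z01; have /andP[z0 z1] := z01.
have p0 : 0 < (1 - z) `^ g by rewrite powR_gt0 // subr_gt0.
have -> : (fun K => \sum_(k < K) b k * z ^+ k) =
    (fun K => ((1 - z) `^ g)^-1 * damped_sum K z).
  by apply/funext => K; rewrite /damped_sum mulrA mulVf ?mul1r // gt_eqF.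
rewrite powRN -[X in _ --> X]mulr1; apply: cvgMr.
apply: (@squeeze_cvgr _ _ _ _ (fun K => 1 - K%:R * b K * z ^+ K / (1 - z)) (fun=> 1)).
- by near=> K; apply: damped_sum_bounds => //; near: K; exists 1%N.
- rewrite -[X in _ --> X]subr0; apply: cvgB; first exact: cvg_cst.
  rewrite -[X in _ --> X](mul0r (1 - z)^-1); apply: cvgMl; exact: rising_binom_tail.
- exact: cvg_cst.
Unshelve. all: end_near.
Qed.

End BinomialSeries.

(** * Laplace transforms and moment sequences as multipliers *)

Section LaplaceMultipliers.
Variable R : realType.
Implicit Types (u v L : nat -> R).

Lemma cvg_powR (T : Type) (F : set_system T) (FF : Filter F) (f : T -> R) (l a : R) :
  0 < l -> f @ F --> l -> (fun x => f x `^ a) @ F --> l `^ a.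
Proof.
move=> l0 fl; have h : {for l, continuous (fun x : R => x `^ a)}.
  apply: differentiable_continuous; apply/derivable1_diffP.
  by have [] := is_derive1_powR a l0.
exact: (cvg_comp _ _ fl h).
Qed.

Lemma hypo_multX v k : hypo_mult v -> hypo_mult (fun n => v n ^+ k).
Proof.
move=> hv; elim: k => [|k IH].
  by apply: hypo_mult_ext (hypo_mult_cst (@ler01 R)) => n _; rewrite expr0.
by apply: hypo_mult_ext (hypo_mult_mul hv IH) => n _; rewrite exprS.
Qed.

(** L^-g is the limit of d^g (1 - e^(-d L))^-g as d tends to 0, and the binomial
    series expands the latter with nonnegative coefficients in powers of
    e^(-d L). *)
Lemma hypo_mult_powRN L (g : R) : 0 < g ->
  (forall n, (1 < n)%N -> 0 < L n) ->
  (forall d, 0 < d -> hypo_mult (fun n => expR (- (d * L n)))) ->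
  hypo_mult (fun n => L n `^ (- g)).
Proof.
move=> g0 L0 hL.
pose d i : R := i.+1%:R^-1.
have d0 i : 0 < d i by rewrite invr_gt0.
pose q i n := expR (- (d i * L n)).
have q01 i n : (1 < n)%N -> 0 < q i n < 1.
  by move=> n1; rewrite expR_gt0 expR_lt1 oppr_lt0 mulr_gt0 ?L0.
apply: (@hypo_mult_lim _ (fun i n => d i `^ g * (1 - q i n) `^ (- g))).
  move=> i; apply: hypo_mult_mul; first by apply: hypo_mult_cst; exact: powR_ge0.
  apply: (@hypo_mult_lim _ (fun K n => \sum_(k < K) rising_binom g k * q i n ^+ k)).
    move=> K; apply: hypo_mult_sum => k _; apply: hypo_mult_mul.
      by apply: hypo_mult_cst; rewrite rising_binom_ge0 // ltW.
    by apply: hypo_multX; exact: hL.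
  by move=> n n1; apply: rising_binom_series => //; exact: q01.
move=> n n1; have l0 := L0 n n1.
have -> : (fun i => d i `^ g * (1 - q i n) `^ (- g)) =
          (fun i => ((1 - q i n) / d i) `^ (- g)).
  apply/funext => i; have /andP[_ q1] := q01 i n n1.
  rewrite powRM ?invr_ge0 ?subr_ge0 ?(ltW q1) ?(ltW (d0 i)) // mulrC; congr (_ * _).
  by rewrite -powR_inv1 ?(ltW (d0 i)) // -powRrM mulN1r opprK.
apply: cvg_powR => //.
(* 1 - e^-y lies between y / (1 + y) and y. *)
have y0 i : 0 < d i * L n by rewrite mulr_gt0.
have y1 i : 0 < 1 + d i * L n by rewrite addr_gt0.
apply: (@squeeze_cvgr _ _ _ _ (fun i => L n / (1 + d i * L n)) (fun=> L n)).
- apply: nearW => i; apply/andP; split.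
    rewrite ler_pdivlMr // -mulrA [_^-1 * _]mulrC mulrA ler_pdivrMr //.
    have : q i n <= (1 + d i * L n)^-1.
      by rewrite /q expRN lef_pV2 ?posrE ?expR_gt0 // expR_ge1Dx.
    rewrite -[(1 + _)^-1]mul1r ler_pdivlMr //.
    by have := d0 i; nra.
  rewrite ler_pdivrMr // mulrC.
  by have := expR_ge1Dx (- (d i * L n)); rewrite -/(q i n); lra.
- rewrite -[X in _ --> X]divr1; apply: cvgMr; apply: cvgV; first exact: oner_neq0.
  rewrite -[X in _ --> X]addr0; apply: cvgD; first exact: cvg_cst.
  rewrite -[X in _ --> X](mul0r (L n)); apply: cvgMl.
  exact: cvg_harmonic.
- exact: cvg_cst.
Qed.

Lemma hypo_mult_ln2 : hypo_mult (fun n => (ln (n%:R : R) ^+ 2)^-1).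
Proof.
have := @hypo_mult_powRN (fun n => ln (n%:R : R)) 2 ltac:(by []) _ _.
have h n : (1 < n)%N -> 0 < ln (n%:R : R) by move=> n1; rewrite ln_gt0 // ltr1n.
move=> /(_ h) H.
apply: (hypo_mult_ext _ (H _)) => [n n1|d d0].
  by rewrite powRN powR_mulrn // ltW // h.
apply: hypo_mult_completely_multiplicative => [n|m n m0 n0]; first exact: expR_ge0.
by rewrite natrM lnM ?posrE ?ltr0n // -expRD; congr expR; ring.
Qed.

(** Functions of the exponent of one prime. Every r^k with r >= 0 is of this kind,
    since r to the exponent of p in n is completely multiplicative in n. *)
Definition hypo_seq (x : nat -> R) : Prop :=
  forall p, prime p -> hypo_mult (fun n => x (logn p n)).

Lemma hypo_seq_powRN (y g : R) : 0 < y -> 0 < g ->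
  hypo_seq (fun k => (k%:R + y) `^ (- g)).
Proof.
move=> y0 g0 p pp; apply: (@hypo_mult_powRN (fun n => (logn p n)%:R + y)) => //.
  by move=> n _; rewrite ltr_wpDl.
move=> d d0.
apply: hypo_mult_ext (hypo_mult_mul (hypo_mult_cst (expR_ge0 (- (d * y))))
   (hypo_mult_completely_multiplicative (chi := fun n => expR (- d) ^+ logn p n) _ _)) => [n _|n|m n m0 n0].
- by rewrite -expRM_natl -expRD; congr expR; ring.
- by rewrite exprn_ge0 ?expR_ge0.
- by rewrite lognM // exprD.
Qed.

Lemma rising_binom_gt0 (b : R) k : 0 < b -> 0 < rising_binom b k.
Proof. by move=> b0; rewrite prodr_gt0 // => i _; rewrite divr_gt0 // ltr_wpDr. Qed.

(** With c_k the rising binomial coefficients, 1 / c_k is the limit in M of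
    c_(k + M) / (c_k c_M), as in Euler's product for the Gamma function, and
    c_(k + M) / c_k is the product over i < M of 1 + b / (k + i + 1), in which
    each factor is a multiplier. *)
Lemma hypo_seq_rising_binom (b : R) : 0 < b ->
  hypo_seq (fun k => (rising_binom (b + 1) k)^-1).
Proof.
move=> b0 p pp; pose c := rising_binom (b + 1).
have c0 k : 0 < c k by apply: rising_binom_gt0; rewrite addr_gt0.
have cS k : c k.+1 = c k * (1 + b * (k%:R + 1)^-1).
  rewrite /c {1}/rising_binom big_ord_recr /= -/(rising_binom _ _); congr (_ * _).
  have k1 : k%:R + 1 != 0 :> R by rewrite natr1 pnatr_eq0.
  by rewrite -natr1; field.
have prodE k M : \prod_(i < M) (1 + b * (k%:R + (i%:R + 1))^-1) = c (k + M)%N / c k.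
  elim: M => [|M IH]; first by rewrite big_ord0 addn0 divff ?gt_eqF.
  by rewrite big_ord_recr /= IH addnS cS natrD addrA; ring.
apply: (@hypo_mult_lim _ (fun M n => (c M)^-1 *
   \prod_(i < M) (1 + b * ((logn p n)%:R + (i%:R + 1))^-1))).
  move=> M; apply: hypo_mult_mul; first by apply: hypo_mult_cst; rewrite invr_ge0 ltW.
  apply: hypo_mult_prod => i _; apply: hypo_mult_add; first exact: hypo_mult_cst.
  apply: hypo_mult_mul; first by apply: hypo_mult_cst; exact: ltW.
  have i0 : 0 < i%:R + 1 :> R by rewrite ltr_wpDl.
  apply: hypo_mult_ext (hypo_seq_powRN i0 ltr01 pp) => n _.
  by rewrite powR_inv1 // addr_ge0 // ltW.
move=> n _; move: (logn p n) => k.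
have -> : (fun M => (c M)^-1 * \prod_(i < M) (1 + b * (k%:R + (i%:R + 1))^-1))
    = (fun M => (c M)^-1 * c (k + M)%N * (c k)^-1).
  by apply/funext => M; rewrite prodE mulrA.
rewrite -[X in _ --> X]mul1r; apply: cvgMl.
elim: k => [|k IH].
  apply: cvg_near_cst; apply: nearW => M.
  by rewrite add0n mulVf ?gt_eqF.
have -> : (fun M => (c M)^-1 * c (k.+1 + M)%N)
    = (fun M => (c M)^-1 * c (k + M)%N * (1 + b * ((k + M)%:R + 1)^-1)).
  by apply/funext => M; rewrite addSn cS mulrA.
rewrite -[X in _ --> X]mulr1; apply: cvgM => //.
rewrite -[X in _ --> X]addr0; apply: cvgD; first exact: cvg_cst.
rewrite -[X in _ --> X](mulr0 b); apply: cvgMr.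
apply: (@squeeze_cvgr _ _ _ _ (fun=> 0) (@harmonic R)); last exact: cvg_harmonic.
  apply: nearW => M; rewrite invr_ge0 addr_ge0 //= lef_pV2 ?posrE ?ltr_wpDl //.
  by rewrite natr1 ler_nat ltnS leq_addl.
exact: cvg_cst.
Qed.

(** The multiplicative function with value u k at p^k for every prime p. *)
Definition mult_fun u (n : nat) : R :=
  \prod_(0 <= p < n.+1 | prime p) u (logn p n).

Lemma mult_funE u n N : u 0%N = 1 -> (n < N)%N ->
  mult_fun u n = \prod_(0 <= p < N | prime p) u (logn p n).
Proof.
move=> u0 nN; rewrite [RHS](big_cat_nat _ nN) //= [X in _ * X]big1_seq ?mulr1 //.
move=> p /andP[pp]; rewrite mem_index_iota => /andP[np _].
rewrite lognE; case: n {nN} np => [|n] np; first by rewrite andbF.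
by rewrite pp /= gtnNdvd.
Qed.

Lemma hypo_mult_mult_fun u : u 0%N = 1 ->
  hypo_seq (fun k => (u k)^-1) -> hypo_mult (fun n => (mult_fun u n)^-1).
Proof.
move=> u0 hu.
apply: (@hypo_mult_lim _ (fun N n => \prod_(0 <= p < N | prime p) (u (logn p n))^-1)).
  by move=> N; apply: hypo_mult_prod => p; exact: hu.
move=> n _; apply: cvg_near_cst; exists n.+1 => // N /= nN.
by rewrite (mult_funE u0 nN) prodfV.
Qed.

End LaplaceMultipliers.

(** * Multiplicative weights *)

Section Weights.
Variable R : realType.
Implicit Types (u w : nat -> R).

(** All that is used of the weights: moderate growth along prime factors, and
    the multiplier property which makes hyponormality available. *)
Definition good_weight w : Prop :=
  [/\ w 1%N = 1,
      exists C : R, forall p n, prime p -> (0 < n)%N -> w n <= w (p * n)%N <= C * w n &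
      hypo_mult (fun n => (w n)^-1)].

Lemma good_weight_ext w w' :
  (forall n, (0 < n)%N -> w n = w' n) -> good_weight w -> good_weight w'.
Proof.
move=> e [w1 [C wC] hw]; split; first by rewrite -e.
  exists C => p n pp n0; rewrite -!e ?muln_gt0 ?n0 ?(prime_gt0 pp) //.
  exact: wC.
by apply: hypo_mult_ext hw => n n1; rewrite e // ltnW.
Qed.

Lemma mult_fun_prime u p n : u 0%N = 1 -> (forall k, 0 < u k) -> prime p -> (0 < n)%N ->
  mult_fun u (p * n) = mult_fun u n * (u (logn p n).+1 / u (logn p n)).
Proof.
move=> u0 up pp n0; set N := (p * n).+1.
have nN : (n < N)%N by rewrite ltnS leq_pmull // prime_gt0.
have pN : p \in index_iota 0 N.
  by rewrite mem_index_iota ltnS leq_pmulr.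
rewrite (mult_funE u0 nN) /mult_fun -/N.
rewrite !(big_mkcond prime) !(bigD1_seq p) ?iota_uniq //= pp.
rewrite lognM ?(prime_gt0 pp) // logn_prime // eqxx add1n.
set A := \prod_(_ <- _ | _) _; set A' := \prod_(_ <- _ | _) _.
have -> : A = A'.
  apply: eq_bigr => q qp; case: ifP => // pq.
  by rewrite lognM ?(prime_gt0 pp) // logn_prime // (negbTE qp) add0n.
by field; rewrite gt_eqF.
Qed.

Lemma mult_fun_good u (C : R) : u 0%N = 1 -> (forall k, 0 < u k) ->
  (forall k, u k <= u k.+1 <= C * u k) -> hypo_seq (fun k => (u k)^-1) ->
  good_weight (mult_fun u).
Proof.
move=> u0 up uC hu; split; last exact: hypo_mult_mult_fun.
  by rewrite /mult_fun big1 // => p _; rewrite logn1.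
exists C => p n pp n0; rewrite mult_fun_prime //.
have m0 : 0 < mult_fun u n by apply: prodr_gt0.
have /andP[h1 h2] := uC (logn p n).
rewrite ler_pMr // ler_pdivlMr // mul1r h1 /=.
by rewrite mulrC ler_wpM2r ?(ltW m0) // ler_pdivrMr.
Qed.

Lemma size_divisors n : size (divisors n) = (\prod_(p <- primes n) (logn p n).+1)%N.
Proof.
have E pe l : size (PrimeDecompAux.add_divisors pe l) = (pe.2.+1 * size l)%N.
  case: pe => p e; rewrite /PrimeDecompAux.add_divisors /=.
  elim: e => [|e IH] /=; first by rewrite mul1n.
  by rewrite size_merge size_cat size_map IH; lia.
rewrite -[RHS](big_map (fun p => (p, logn p n)) predT (fun pe => pe.2.+1)).
rewrite -prime_decompE /divisors; elim: (prime_decomp n) => [|pe s IH] /=.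
  by rewrite big_nil.
by rewrite E IH big_cons.
Qed.

Lemma prod_primes u n : u 0%N = 1 -> (0 < n)%N ->
  \prod_(p <- primes n) u (logn p n) = mult_fun u n.
Proof.
move=> u0 n0; rewrite /mult_fun [RHS](bigID (fun p => p \in primes n)) /=.
rewrite [X in _ = _ * X]big1 ?mulr1; last first.
  by move=> p /andP[pp pn]; move: pn; rewrite -logn_gt0 lt0n negbK => /eqP ->.
rewrite -[RHS]big_filter; apply: perm_big; apply: uniq_perm.
- exact: primes_uniq.
- by rewrite filter_uniq ?iota_uniq.
move=> p; rewrite mem_filter mem_index_iota /= ltnS mem_primes.
case: (boolP (prime p)) => //= pp; rewrite n0 /= andbC; case: (boolP (p %| n)%N) => [pn|]; rewrite ?andbF //.
by rewrite dvdn_leq.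
Qed.

Lemma divisor_weight (b : R) n : (0 < n)%N ->
  (size (divisors n))%:R `^ b = mult_fun (fun k => (k%:R + 1) `^ b) n.
Proof.
move=> n0; rewrite -prod_primes //; last by rewrite add0r powR1.
rewrite size_divisors; elim: (primes n) => [|p s IH].
  by rewrite !big_nil powR1.
by rewrite !big_cons natrM powRM // IH natr1.
Qed.

Lemma divisor_weight_good (b : R) : 0 < b ->
  good_weight (fun n => (size (divisors n))%:R `^ b).
Proof.
move=> b0.
apply: (@good_weight_ext (mult_fun (fun k => (k%:R + 1) `^ b))).
  by move=> n n0; rewrite divisor_weight.
have k0 k : 0 < k%:R + 1 :> R by rewrite ltr_wpDl.
apply: (@mult_fun_good _ (2 `^ b)).
- by rewrite add0r powR1.
- by move=> k; apply: powR_gt0.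
- move=> k; rewrite -powRM ?(ltW (k0 k)) //.
  have kS : k.+1%:R = k%:R + 1 :> R by rewrite natr1.
  have := ler0n R k; rewrite kS; move: (k%:R : R) => x x0.
  by apply/andP; split; apply: ge0_ler_powR; rewrite ?nnegrE ?(ltW b0) //; lra.
- move=> p pp; apply: hypo_mult_ext (hypo_seq_powRN ltr01 b0 pp) => n _.
  by rewrite powRN.
Qed.

Lemma rising_binom_good (b : R) : 0 < b ->
  good_weight (mult_fun (rising_binom (b + 1))).
Proof.
move=> b0; have b1 : 0 < b + 1 by rewrite addr_gt0.
apply: (@mult_fun_good _ (b + 1)).
- by rewrite /rising_binom big_ord0.
- by move=> k; apply: rising_binom_gt0.
- move=> k; have c0 := rising_binom_gt0 k b1.
  have k1 : 1 <= k.+1%:R :> R by rewrite ler1n.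
  rewrite {2 3}/rising_binom big_ord_recr /= -/(rising_binom _ _).
  rewrite ler_pMr // [(b + 1) * _]mulrC ler_pM2l //.
  rewrite ler_pdivlMr ?ler_pdivrMr ?ltr0n //; move: k1; rewrite -natr1 => k1.
  by apply/andP; split; nra.
- exact: hypo_seq_rising_binom.
Qed.

End Weights.

(** * Finite Euler products *)

Lemma prime_prod_recr (R : comPzRingType) (F : nat -> R) P :
  \prod_(0 <= p < P.+1 | prime p) F p =
  \prod_(0 <= p < P | prime p) F p * (if prime P then F P else 1).
Proof. by rewrite big_mkcond big_nat_recr //= -big_mkcond. Qed.

Section EulerProduct.
Variables (R : realType) (s : R).
Implicit Types (u : nat -> R).

Local Notation t n := ((n%:R : R) `^ (- s)).

Definition smooth (P n : nat) : bool := all (fun q => (q < P)%N) (primes n).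

Lemma mult_fun_primeX u p k m : u 0%N = 1 -> (forall k, 0 < u k) ->
  prime p -> (0 < m)%N -> logn p m = 0%N ->
  mult_fun u (p ^ k * m) = u k * mult_fun u m.
Proof.
move=> u0 up pp m0 pm; elim: k => [|k IH]; first by rewrite expn0 mul1n u0 mul1r.
rewrite expnS -mulnA mult_fun_prime // ?muln_gt0 ?expn_gt0 ?(prime_gt0 pp) //.
rewrite lognM ?expn_gt0 ?(prime_gt0 pp) // pfactorK // pm addn0 IH.
by field; rewrite gt_eqF.
Qed.

Lemma powR_natM m n : t (m * n)%N = t m * t n.
Proof. by rewrite natrM powRM. Qed.

Lemma powR_natX p k : t (p ^ k)%N = t p ^+ k.
Proof.
elim: k => [|k IH]; first by rewrite expn0 expr0 powR1.
by rewrite expnS powR_natM IH exprS.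
Qed.

Lemma smooth_logn p m : (0 < m)%N -> smooth p m -> logn p m = 0%N.
Proof.
move=> m0 /allP h; apply/eqP; rewrite -leqn0 leqNgt logn_gt0.
by apply/negP => /h; rewrite ltnn.
Qed.

Lemma smooth_split p n : prime p -> (0 < n)%N -> smooth p.+1 n ->
  exists m, [/\ (0 < m)%N, smooth p m & n = (p ^ logn p n * m)%N].
Proof.
move=> pp n0 /allP h; have [m cop E] := pfactor_coprime pp n0.
have m0 : (0 < m)%N by move: n0; rewrite {1}E muln_gt0 => /andP[].
exists m; split=> //; last by rewrite mulnC.
apply/allP => q; rewrite mem_primes => /and3P[pq _ qm].
have : q \in primes n by rewrite mem_primes pq n0 E dvdn_mulr.
move/h; rewrite ltnS leq_eqVlt => /predU1P[qp|//].
by move: cop; rewrite prime_coprime // -qp qm.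
Qed.

Lemma smoothS p n : smooth p n -> smooth p.+1 n.
Proof. by move/allP=> h; apply/allP => q /h /ltnW. Qed.

Lemma smooth_mul p k m : prime p -> (0 < m)%N -> smooth p m ->
  smooth p.+1 (p ^ k * m).
Proof.
move=> pp m0 /smoothS/allP h; apply/allP => q.
rewrite mem_primes => /and3P[pq _]; rewrite Euclid_dvdM // => /orP[|qm].
  by rewrite Euclid_dvdX // => /andP[/dvdn_leq -/(_ (prime_gt0 pp))].
by apply: h; rewrite mem_primes pq m0.
Qed.

Lemma smooth_notprime p n : ~~ prime p -> smooth p.+1 n = smooth p n.
Proof.
move=> np; apply/idP/idP => [/allP h|/smoothS //]; apply/allP => q qn.
have := h q qn; rewrite ltnS leq_eqVlt => /predU1P[qp|//].
by move: qn np; rewrite mem_primes qp => /and3P[->].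
Qed.

Variable u : nat -> R.
Hypotheses (u0 : u 0%N = 1) (up : forall k, 0 < u k).
Let a n := mult_fun u n * t n.

Let a_ge0 n : 0 <= a n.
Proof. by rewrite mulr_ge0 ?powR_ge0 // prodr_ge0 // => p _; rewrite ltW. Qed.

Let aM p k m : prime p -> (0 < m)%N -> smooth p m ->
  a (p ^ k * m) = u k * t p ^+ k * a m.
Proof.
move=> pp m0 sm; rewrite /a mult_fun_primeX // ?smooth_logn // powR_natM powR_natX; ring.
Qed.

Lemma smooth1 n : (0 < n)%N -> smooth 0 n = (n == 1)%N.
Proof.
move=> n0; apply/idP/eqP => [/allP h|-> //]; apply/eqP; rewrite eqn_leq n0 andbT leqNgt.
by apply/negP => n1; have := h (pdiv n); rewrite mem_primes pdiv_prime // n0 pdiv_dvd => /(_ erefl).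
Qed.

Let a1 : a 1%N = 1.
Proof. by rewrite /a powR1 mulr1 /mult_fun big1 // => p _; rewrite logn1. Qed.

(** Every (P+1)-smooth n is uniquely p^k m with p = P and m P-smooth, and k < n;
    so the sum is part of the expanded product. *)
Lemma smooth_sum_le P N :
  \sum_(1 <= n < N | smooth P n) a n <=
  \prod_(0 <= p < P | prime p) \sum_(k < N) u k * t p ^+ k.
Proof.
elim: P => [|P IH].
  rewrite big_geq //.
  rewrite (_ : \sum_(1 <= n < N | smooth 0 n) a n = \sum_(1 <= n < N | n == 1%N) a n).
    by rewrite big_nat1_eq a1; case: ifP.
  rewrite big_nat_cond [RHS]big_nat_cond; apply: eq_bigl => n.
  by case: (boolP (0 < n < N)%N) => // /andP[n0 _]; rewrite smooth1.
rewrite prime_prod_recr.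
case: (boolP (prime P)) => pp; last first.
  rewrite mulr1; apply: le_trans IH; rewrite le_eqVlt; apply/orP; left; apply/eqP.
  by apply: eq_bigl => n; rewrite smooth_notprime.
have hc k : 0 <= u k * t P ^+ k by rewrite mulr_ge0 ?exprn_ge0 ?powR_ge0 // ltW.
apply: le_trans (ler_wpM2r (sumr_ge0 _ _) IH) => [|k _]; last exact: hc.
rewrite -(big_mkord predT (fun k => u k * t P ^+ k)).
rewrite -[X in X <= _]big_filter -[X in X * _]big_filter [leRHS]mulrC.
set S := [seq n <- index_iota 1 N | smooth P n].
set S' := [seq n <- index_iota 1 N | smooth P.+1 n].
have S'E n : n \in S' -> (0 < n)%N /\ smooth P.+1 n.
  by rewrite mem_filter mem_index_iota => /and3P[-> ->].
have E n : n \in S' -> [/\ (0 < n %/ P ^ logn P n)%N, smooth P (n %/ P ^ logn P n)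
    & (P ^ logn P n * (n %/ P ^ logn P n))%N = n].
  move=> /S'E[n0 sn]; have [m [m0 sm e]] := smooth_split pp n0 sn.
  have e' : (n %/ P ^ logn P n)%N = m.
    by rewrite {1}e mulnC mulnK // expn_gt0 prime_gt0.
  by rewrite e' -e.
rewrite mulr_suml; under [leRHS]eq_bigr do rewrite mulr_sumr.
rewrite (_ : \sum_(0 <= k < N) \sum_(m <- S) u k * t P ^+ k * a m =
  \sum_(km <- [seq (k, m) | k <- index_iota 0 N, m <- S])
     u km.1 * t P ^+ km.1 * a km.2); last by rewrite big_allpairs.
apply: le_trans (ler_sum_inj (s := S') (h := fun n => (logn P n, n %/ P ^ logn P n)%N) _ _ _ _ _).
- rewrite le_eqVlt; apply/orP; left; apply/eqP.
  rewrite big_seq [RHS]big_seq; apply: eq_bigr => n /E[m0 sm e] /=.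
  by rewrite -aM // e.
- by rewrite filter_uniq ?iota_uniq.
- by apply: allpairs_uniq; rewrite ?filter_uniq ?iota_uniq // => -[? ?] [? ?].
- move=> n nS; have [m0 sm e] := E n nS; have := nS.
  rewrite mem_filter mem_index_iota => /and3P[_ n0 nN].
  apply: allpairs_f; first by rewrite mem_index_iota /= (leq_trans _ nN) // ltnS ltnW // ltn_logl.
  rewrite mem_filter sm mem_index_iota m0 /= (leq_trans _ nN) // ltnS.
  by rewrite leq_div.
- by move=> n n' /E[_ _ e] /E[_ _ e'] [h1 h2]; have := e; rewrite h2 h1 e'.
- by move=> [k m] _; rewrite mulr_ge0.
Qed.

Lemma smooth_sum_ge P K : exists M,
  \prod_(0 <= p < P | prime p) \sum_(k < K) u k * t p ^+ k <=
  \sum_(1 <= n < M | smooth P n) a n.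
Proof.
elim: P => [|P [M IH]].
  exists 2%N; rewrite big_geq // (_ : index_iota 1 2 = [:: 1%N]) //.
  by rewrite big_cons big_nil smooth1 //= a1 addr0.
have hc k : 0 <= u k * t P ^+ k by rewrite mulr_ge0 ?exprn_ge0 ?powR_ge0 // ltW.
rewrite prime_prod_recr.
case: (boolP (prime P)) => pp; last first.
  exists M; rewrite mulr1; apply: le_trans IH _; rewrite le_eqVlt; apply/orP; left; apply/eqP.
  by apply: eq_bigl => n; rewrite smooth_notprime.
exists (P ^ K * M).+1%N.
apply: le_trans (ler_wpM2r (sumr_ge0 _ _) IH) _ => [k _|]; first exact: hc.
rewrite -(big_mkord predT (fun k => u k * t P ^+ k)).
rewrite -[leRHS]big_filter -[X in X * _]big_filter [leLHS]mulrC.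
set S := [seq n <- index_iota 1 M | smooth P n].
rewrite mulr_suml; under [leLHS]eq_bigr do rewrite mulr_sumr.
rewrite (_ : \sum_(0 <= k < K) \sum_(m <- S) u k * t P ^+ k * a m =
  \sum_(km <- [seq (k, m) | k <- index_iota 0 K, m <- S])
     u km.1 * t P ^+ km.1 * a km.2); last by rewrite big_allpairs.
have SE m : m \in S -> [/\ (0 < m)%N, (m < M)%N & smooth P m].
  by rewrite mem_filter mem_index_iota => /and3P[-> -> ->].
rewrite (_ : \sum_(km <- _) _ = \sum_(km <- [seq (k, m) | k <- index_iota 0 K, m <- S])
     a (P ^ km.1 * km.2)%N); last first.
  rewrite big_seq [RHS]big_seq; apply: eq_bigr => _ /allpairsP[[k m] /= [_ /SE[m0 _ sm] ->]] /=.
  by rewrite aM.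
apply: (@ler_sum_inj _ _ _ _ _ (fun km => P ^ km.1 * km.2)%N a).
- by apply: allpairs_uniq; rewrite ?filter_uniq ?iota_uniq // => -[? ?] [? ?].
- by rewrite filter_uniq ?iota_uniq.
- move=> _ /allpairsP[[k m] /= [+ /SE[m0 mM sm] ->]] /=; rewrite mem_index_iota => /andP[_ kK].
  rewrite mem_filter smooth_mul //= mem_index_iota muln_gt0 expn_gt0 prime_gt0 //= m0 ltnS.
  by rewrite leq_mul ?(ltnW mM) // leq_exp2l ?prime_gt1 // ltnW.
- move=> _ _ /allpairsP[[k m] /= [_ /SE[m0 _ sm] ->]] /allpairsP[[k' m'] /= [_ /SE[m0' _ sm'] ->]] /= e.
  have kk : k = k'.
    have := congr1 (logn P) e; rewrite !lognM ?expn_gt0 ?(prime_gt0 pp) // !pfactorK //.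
    by rewrite !smooth_logn // !addn0.
  move: e; rewrite kk => /eqP; rewrite eqn_pmul2l ?expn_gt0 ?(prime_gt0 pp) // => /eqP ->.
  by [].
- by move=> n _; exact: a_ge0.
Qed.

End EulerProduct.

(** * Powers of the zeta function *)

Section ZetaPower.
Variable R : realType.

Lemma le_powRN_exp (n : nat) (x y : R) : (0 < n)%N -> x <= y ->
  (n%:R : R) `^ x <= n%:R `^ y.
Proof. by move=> n0 xy; apply: ler_powR => //; rewrite ler1n. Qed.

(** Telescoping, from 1 / (x + 1)^2 <= 1 / x - 1 / (x + 1). *)
Lemma sum_inv_sq_le N : \sum_(1 <= n < N) (n%:R : R) `^ (- 2) <= 2.
Proof.
have H N' : \sum_(1 <= n < N'.+2) (n%:R : R) `^ (- 2) <= 2 - N'.+1%:R^-1.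
  elim: N' => [|N' IH].
    by rewrite big_nat1 powR1 invr1; lra.
  rewrite big_nat_recr //=; apply: le_trans (lerD IH (lexx _)) _.
  have -> : N'.+2%:R `^ (- 2) = (N'.+2%:R ^+ 2)^-1 :> R by rewrite powRN powR_mulrn.
  have x0 : 0 < N'.+1%:R :> R by [].
  rewrite -[N'.+2%:R]natr1; move: (N'.+1%:R : R) x0 => x x0.
  have -> : 2 - x^-1 + ((x + 1) ^+ 2)^-1 = 2 - (x + 1)^-1 - (x * (x + 1) ^+ 2)^-1.
    by field; rewrite !gt_eqF // ltr_wpDr.
  by rewrite lerBlDr lerDl invr_ge0 mulr_ge0 ?exprn_ge0 ?addr_ge0 ?ltW.
case: N => [|[|N]]; [by rewrite big_geq|by rewrite big_geq|].
apply: le_trans (H N) _.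
by rewrite lerBlDr lerDl invr_ge0.
Qed.

Lemma zeta_partial_le (s : R) N : 2 <= s ->
  \sum_(1 <= n < N) (n%:R : R) `^ (- s) <= 2.
Proof.
move=> s2; apply: le_trans (sum_inv_sq_le N); apply: ler_sum_nat => n /andP[n0 _].
by apply: le_powRN_exp; rewrite ?lerN2.
Qed.

Lemma nondecreasing_sum (f : nat -> R) : (forall n, 0 <= f n) ->
  {homo (fun N => \sum_(1 <= n < N) f n) : n m / (n <= m)%N >-> n <= m}.
Proof.
move=> f0 n m nm; case: n nm => [|n] nm; first by rewrite big_geq // sumr_ge0.
by rewrite (big_cat_nat _ nm) //= lerDl sumr_ge0.
Qed.

Lemma cvg_zeta (s : R) : 2 <= s ->
  (fun N => \sum_(1 <= n < N) (n%:R : R) `^ (- s)) @ \oo --> zeta s.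
Proof.
move=> s2; apply: nondecreasing_is_cvgn.
  by apply: nondecreasing_sum => n; exact: powR_ge0.
by exists 2 => _ [N _ <-]; exact: zeta_partial_le.
Qed.

Lemma rising_binom1 k : rising_binom (1 : R) k = 1.
Proof. by apply: big1 => i _; rewrite addrC natr1 divff. Qed.

Lemma mult_fun1 n : mult_fun (rising_binom (1 : R)) n = 1.
Proof. by apply: big1 => p _; rewrite rising_binom1. Qed.

Section Bounds.
Variables (s g : R).
Hypotheses (s2 : 2 <= s) (g0 : 0 < g).
Local Notation t n := ((n%:R : R) `^ (- s)).
Local Notation D := (mult_fun (rising_binom g)).

Let t01 p : prime p -> 0 < t p < 1.
Proof.
move=> pp; rewrite powR_gt0 ?ltr0n ?prime_gt0 //=.
rewrite powRN invf_lt1 ?powR_gt0 ?ltr0n ?prime_gt0 //.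
rewrite -[X in X < _](powRr0 (p%:R : R)); rewrite /powR.
rewrite pnatr_eq0 eqn0Ngt prime_gt0 //= ltr_expR mul0r mulr_gt0 ?ln_gt0 ?ltr1n ?prime_gt1 //.
exact: lt_le_trans s2.
Qed.

Let u0 : rising_binom g 0 = 1. Proof. by rewrite /rising_binom big_ord0. Qed.

Let D0 n : 0 <= D n.
Proof. by apply: prodr_ge0 => p _; apply: rising_binom_ge0; exact: ltW. Qed.

Lemma euler_cvg P :
  (fun K => \prod_(0 <= p < P | prime p) \sum_(k < K) rising_binom g k * t p ^+ k)
  @ \oo --> \prod_(0 <= p < P | prime p) (1 - t p) `^ (- g).
Proof.
apply: cvg_big => [|p pp]; first exact: mul_continuous.
by apply: rising_binom_series => //; exact: t01.
Qed.

Lemma euler_sum_le N :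
  \sum_(1 <= n < N) D n * t n <= \prod_(0 <= p < N | prime p) (1 - t p) `^ (- g).
Proof.
have := @smooth_sum_le R s (rising_binom g) u0 (fun k => rising_binom_gt0 k g0) N N.
rewrite (_ : \sum_(1 <= n < N | smooth N n) _ = \sum_(1 <= n < N) D n * t n); last first.
  rewrite big_nat_cond [RHS]big_nat_cond; apply: eq_bigl => n.
  rewrite andbT andb_idr // => /andP[n0 nN]; apply/allP => q.
  by rewrite mem_primes => /and3P[_ _ /dvdn_leq -/(_ n0) h]; apply: leq_ltn_trans nN.
move/le_trans; apply; apply: ler_prod => p pp; rewrite sumr_ge0 /=; last first.
  by move=> k _; rewrite mulr_ge0 ?exprn_ge0 ?powR_ge0 ?rising_binom_ge0 ?ltW.
rewrite -(cvg_lim _ (rising_binom_series g0 (t01 pp))) //.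
apply: (nondecreasing_cvgn_le (u_ := fun K => \sum_(k < K) rising_binom g k * t p ^+ k)).
  apply/nondecreasing_seqP => n; rewrite big_ord_recr /= lerDl.
  by rewrite mulr_ge0 ?exprn_ge0 ?powR_ge0 ?rising_binom_ge0 ?ltW.
by apply/cvg_ex; eexists; exact: (rising_binom_series g0 (t01 pp)).
Qed.

Lemma euler_prod_le (B : R) N :
  (forall M, \sum_(1 <= n < M) D n * t n <= B) ->
  \prod_(0 <= p < N | prime p) (1 - t p) `^ (- g) <= B.
Proof.
move=> hB; rewrite -(cvg_lim _ (@euler_cvg N)) //.
apply: limr_le; first by apply/cvg_ex; eexists; exact: euler_cvg.
apply: nearW => K.
have [M h] := @smooth_sum_ge R s (rising_binom g) u0 (fun k => rising_binom_gt0 k g0) N K.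
apply: le_trans h (le_trans _ (hB M)).
rewrite big_mkcond; apply: ler_sum => n _; case: ifP => // _.
by rewrite mulr_ge0 ?powR_ge0.
Qed.

End Bounds.

(** With nonnegative terms it is enough to compare upper bounds. Partial sums of
    the series for exponent g lie below finite Euler products to the power g,
    and those products are bounded by every upper bound of the partial sums.
    The case g = 1 relates the Euler products to zeta itself. *)
Lemma zeta_power_series (s g : R) : 2 <= s -> 0 < g ->
  (fun N => \sum_(1 <= n < N) mult_fun (rising_binom g) n * n%:R `^ (- s))
  @ \oo --> zeta s `^ g.
Proof.
move=> s2 g0; pose Q N : R := \prod_(0 <= p < N | prime p) (1 - p%:R `^ (- s)) `^ (- 1).
pose Z N : R := \sum_(1 <= n < N) n%:R `^ (- s).
pose S N : R := \sum_(1 <= n < N) mult_fun (rising_binom g) n * n%:R `^ (- s).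
have Qg N : \prod_(0 <= p < N | prime p) (1 - p%:R `^ (- s)) `^ (- g) = Q N `^ g.
  rewrite /Q; elim: N => [|N IH]; first by rewrite !big_geq // powR1.
  rewrite !prime_prod_recr IH powRM ?prodr_ge0 //; last first.
  - by case: ifP => // _; exact: powR_ge0.
  - by move=> p _; exact: powR_ge0.
  case: ifP => _; last by rewrite powR1.
  by rewrite -powRrM mulN1r.
have ZE N : \sum_(1 <= n < N) mult_fun (rising_binom 1) n * n%:R `^ (- s) = Z N.
  by apply: eq_bigr => n _; rewrite mult_fun1 mul1r.
have Zz N : Z N <= zeta s.
  apply: (nondecreasing_cvgn_le (u_ := Z)); last by apply/cvg_ex; exists (zeta s); exact: cvg_zeta.
  by apply: nondecreasing_sum => n; exact: powR_ge0.
have Qz N : Q N <= zeta s.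
  by apply: (euler_prod_le s2 ltr01) => M; rewrite ZE.
have ZQ N : Z N <= Q N by rewrite -ZE; apply: (euler_sum_le s2 ltr01).
have Z0 N : 0 <= Z N by apply: sumr_ge0 => n _; exact: powR_ge0.
have Q0 N : 0 <= Q N by apply: prodr_ge0 => n _; exact: powR_ge0.
have mono : {in Num.nneg &, {homo (fun x : R => x `^ g) : x y / x <= y}}.
  by apply: ge0_ler_powR; exact: ltW.
have z0 : 0 < zeta s.
  apply: lt_le_trans (Zz 2%N); rewrite /Z big_nat1 powR1; exact: ltr01.
have Sz N : S N <= zeta s `^ g.
  apply: le_trans (euler_sum_le s2 g0 N) _; rewrite Qg.
  by apply: mono; rewrite ?nnegrE ?Q0 ?(ltW z0).
have ndS : {homo S : n m / (n <= m)%N >-> n <= m}.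
  apply: nondecreasing_sum => n; rewrite mulr_ge0 ?powR_ge0 //.
  by apply: prodr_ge0 => p _; apply: rising_binom_ge0; exact: ltW.
have cS : cvgn S.
  by apply: nondecreasing_is_cvgn => //; exists (zeta s `^ g) => _ [N _ <-]; exact: Sz.
suff -> : zeta s `^ g = limn S by exact: cS.
apply/eqP; rewrite eq_le; apply/andP; split; last first.
  by apply: limr_le => //; apply: nearW.
have cZ : (fun N => Z N `^ g) @ \oo --> zeta s `^ g.
  by apply: cvg_powR => //; exact: cvg_zeta.
rewrite -(cvg_lim _ cZ) //; apply: limr_le; first by apply/cvg_ex; exists (zeta s `^ g).
apply: nearW => N; apply: (@le_trans _ _ (Q N `^ g)).
  by apply: mono; rewrite ?nnegrE.
by rewrite -Qg; apply: (euler_prod_le s2 g0) => M; apply: nondecreasing_cvgn_le.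
Qed.

(** If m is the first index with c_m != 0, then c_m m^-s is minus the sum of the
    terms beyond m, which is O((m + 1)^-s). *)
Lemma dirichlet_unique (c : nat -> R) :
  (forall s : R, 2 <= s -> (fun N => \sum_(1 <= n < N) c n * n%:R `^ (- s)) @ \oo --> 0) ->
  forall m, (0 < m)%N -> c m = 0.
Proof.
move=> hc.
have [K K0 hK] : exists2 K : R, 0 <= K & forall n, (0 < n)%N -> `|c n * n%:R `^ (- 2)| <= K.
  have cv := hc 2 (lexx _).
  have : bounded_fun (fun N => \sum_(1 <= n < N) c n * n%:R `^ (- 2)).
    by apply: cvg_seq_bounded; apply/cvg_ex; exists 0.
  rewrite /bounded_fun /bounded_near => -[M [_ hM]].
  have h N : `|\sum_(1 <= n < N) c n * n%:R `^ (- 2)| <= `|M| + 1.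
    by apply: hM => //; rewrite (le_lt_trans (ler_norm _)) // ltrDl.
  exists (`|M| + 1 + (`|M| + 1)); first by rewrite !addr_ge0.
  case=> // n _; apply: le_trans (lerD (h n.+2) (h n.+1)).
  by apply: le_trans (ler_normB _ _); rewrite big_nat_recr //= addrAC subrr add0r.
elim/ltn_ind => m IH m0.
(* At s = 4 + j the bound on the terms for s = 2 leaves a sum of inverse squares. *)
have key j : `|c m| <= 2 * K * (m%:R : R) `^ 4 * (m%:R / m.+1%:R) ^+ j.
  pose s : R := 4 + j%:R.
  have s4 : 4 <= s by rewrite lerDl.
  have s2 : 2 <= s by apply: le_trans s4; lra.
  have mp : 0 < (m%:R : R) `^ (- s) by rewrite powR_gt0 // ltr0n.
  have E N : (m < N)%N -> \sum_(1 <= n < N) c n * n%:R `^ (- s) =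
      c m * m%:R `^ (- s) + \sum_(m.+1 <= n < N) c n * n%:R `^ (- s).
    move=> mN; rewrite (@big_cat_nat _ _ _ m) //=; last exact: ltnW.
    rewrite big_nat big1 ?add0r; last by move=> i /andP[i0 im]; rewrite IH ?mul0r.
    by rewrite big_ltn.
  have T N : `|\sum_(m.+1 <= n < N) c n * n%:R `^ (- s)| <= 2 * K * (m.+1%:R : R) `^ (4 - s).
    apply: le_trans (ler_norm_sum _ _ _) _.
    apply: (@le_trans _ _ (\sum_(m.+1 <= n < N) K * m.+1%:R `^ (4 - s) * n%:R `^ (- 2))).
      apply: ler_sum_nat => n /andP[mn nN].
      have n0 : (0 < n)%N by apply: leq_trans mn.
      have nn : (n%:R : R) != 0 by rewrite pnatr_eq0 -lt0n.
      have -> : c n * n%:R `^ (- s) = (c n * n%:R `^ (- 2)) * n%:R `^ (4 - s) * n%:R `^ (- 2).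
        by rewrite -!mulrA -!powRD ?nn ?implybT //; congr (_ * _ `^ _); ring.
      rewrite normrM [X in _ * X]ger0_norm ?powR_ge0 // ler_wpM2r ?powR_ge0 //.
      rewrite normrM [X in _ * X]ger0_norm ?powR_ge0 // ler_pM ?powR_ge0 ?hK //.
      have -> : 4 - s = - (s - 4) by ring.
      rewrite !powRN lef_pV2 ?posrE ?powR_gt0 ?ltr0n //.
      by apply: ge0_ler_powR; rewrite ?nnegrE ?ler_nat ?subr_ge0.
    rewrite -mulr_sumr [leRHS](_ : _ = K * m.+1%:R `^ (4 - s) * 2); last by ring.
    rewrite ler_wpM2l ?mulr_ge0 ?powR_ge0 //.
    case: (leqP N m.+1) => [h|h]; first by rewrite big_geq.
    apply: le_trans (sum_inv_sq_le N).
    by rewrite [leRHS](@big_cat_nat _ _ _ m.+1) ?(ltnW h) //= lerDr sumr_ge0.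
  have B : `|c m * m%:R `^ (- s)| <= 2 * K * (m.+1%:R : R) `^ (4 - s).
    have lim := cvg_norm (hc s s2); rewrite normr0 in lim.
    apply/ler_addgt0Pl => e e0.
    have : \forall N \near \oo, `|\sum_(1 <= n < N) c n * n%:R `^ (- s)| < e.
      by move/cvgr0Pnorm_lt : (hc s s2); apply.
    move=> [N0 _ hN0].
    have := hN0 (maxn N0 m.+1) (leq_maxl _ _); rewrite E ?leq_maxr // => h1.
    have := T (maxn N0 m.+1) => h2.
    rewrite addrC -(addrK (\sum_(m.+1 <= n < maxn N0 m.+1) c n * n%:R `^ (- s)) (c m * _)).
    by apply: le_trans (ler_normB _ _) _; rewrite addrC lerD // ltW.
  move: B; rewrite normrM [X in _ * X]gtr0_norm // -ler_pdivlMr //.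
  move/le_trans; apply; rewrite le_eqVlt; apply/orP; left; apply/eqP.
  rewrite powRN invrK (_ : 4 - s = - j%:R); last by rewrite /s; ring.
  rewrite powRN expr_div_n /s powRD; last first.
    by rewrite pnatr_eq0 -lt0n m0 implybT.
  by rewrite !(powR_mulrn j) //; ring.
apply/eqP; rewrite -normr_le0.
have lim : (fun j => 2 * K * (m%:R : R) `^ 4 * (m%:R / m.+1%:R) ^+ j) @ \oo --> 0.
  rewrite -[X in _ --> X](mulr0 (2 * K * (m%:R : R) `^ 4)); apply: cvgMr.
  have : (fun n => 1 * (m%:R / m.+1%:R : R) ^+ n) @ \oo --> 0.
    apply: cvg_geometric; rewrite ger0_norm ?divr_ge0 // ltr_pdivrMr // mul1r ltr_nat //.
  by under eq_fun do rewrite mul1r.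
rewrite -(cvg_lim _ lim) //; apply: limr_ge; first by apply/cvg_ex; exists 0.
by apply: nearW.
Qed.

Lemma weight_class_good (w : nat -> R) : weight_class w -> good_weight w.
Proof.
move=> [b [b0 [hw|hw]]].
  by apply: good_weight_ext (divisor_weight_good b0) => n n0; rewrite hw.
apply: good_weight_ext (rising_binom_good b0) => n n0; apply/esym/eqP.
rewrite -subr_eq0; apply/eqP.
apply: (dirichlet_unique (c := fun n => w n - mult_fun (rising_binom (b + 1)) n)) => // s s2.
have b1 : 0 < b + 1 by rewrite addr_gt0.
have s1 : 1 < s by apply: lt_le_trans s2; lra.
have := cvgB (hw s s1) (zeta_power_series s2 b1); rewrite subrr => /(_ _) h.
rewrite (_ : (fun N => _) = (fun N => \sum_(1 <= n < N) w n * n%:R `^ (- s)) -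
    (fun N => \sum_(1 <= n < N) mult_fun (rising_binom (b + 1)) n * n%:R `^ (- s))); first exact: h.
by apply/funext => N; rewrite fctE -sumrB; apply: eq_bigr => i _; rewrite mulrBl.
Qed.

End ZetaPower.

(** * The norm of H2_w *)

Section HilbertSpace.
Variable R : realType.
Local Notation C := R[i].
Implicit Types (a b f h : dseries R) (w : nat -> R).

Lemma good_weight_mulr w m n : good_weight w -> (0 < m)%N -> (0 < n)%N ->
  w n <= w (m * n)%N.
Proof.
move=> gw m0 n0; move: m m0.
apply: (@prime_ind (fun m => w n <= w (m * n)%N)) => [|p m pp m0 IH].
  by rewrite mul1n.
have [_ [C wC] _] := gw; have mn0 : (0 < m * n)%N by rewrite muln_gt0 m0.
by have /andP[+ _] := wC p _ pp mn0; rewrite -mulnA; apply: le_trans.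
Qed.

Lemma good_weight_ge1 w n : good_weight w -> (0 < n)%N -> 1 <= w n.
Proof.
move=> gw n0; have := good_weight_mulr gw n0 (ltnSn 0); rewrite muln1.
by case: (gw) => -> _ _.
Qed.

Lemma good_weight_gt0 w n : good_weight w -> (0 < n)%N -> 0 < w n.
Proof. by move=> gw n0; apply: lt_le_trans (good_weight_ge1 gw n0). Qed.

Section Norm.
Variable w : nat -> R.
Hypothesis gw : good_weight w.

Let term_ge0 a n : (0 < n)%N -> 0 <= sqmod (a n) / w n.
Proof. by move=> n0; rewrite divr_ge0 ?sqmod_ge0 // ltW ?good_weight_gt0. Qed.

Lemma H2_norm_ge0 a : 0 <= H2_norm w a.
Proof. exact: sqrtr_ge0. Qed.

Lemma H2_sqnorm_ge0 a : (0 <= H2_sqnorm w a)%E.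
Proof.
by apply: nneseries_ge0 => n n0 _; rewrite lee_fin; exact: (term_ge0 a n0).
Qed.

Lemma H2_partial_le a N : H2 w a ->
  \sum_(1 <= n < N) sqmod (a n) / w n <= H2_norm w a ^+ 2.
Proof.
move=> ha; rewrite /H2_norm sqr_sqrtr ?fine_ge0 ?H2_sqnorm_ge0 //.
rewrite -lee_fin fineK ?ge0_fin_numE ?H2_sqnorm_ge0 //.
rewrite -sumEFin; apply: (nneseries_lim_ge N) => n n0 _.
by rewrite lee_fin; exact: (term_ge0 a n0).
Qed.

Lemma H2_bounded a (B : R) :
  (forall N, \sum_(1 <= n < N) sqmod (a n) / w n <= B) ->
  H2 w a /\ H2_norm w a ^+ 2 <= B.
Proof.
move=> hB; have h : (H2_sqnorm w a <= B%:E)%E.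
  apply: lime_le.
    by apply: is_cvg_nneseries => n n0 _; rewrite lee_fin; exact: (term_ge0 a n0).
  by apply: nearW => N; rewrite sumEFin lee_fin; exact: hB.
have ha : H2 w a by apply: le_lt_trans h (ltry _).
split=> //; rewrite /H2_norm sqr_sqrtr ?fine_ge0 ?H2_sqnorm_ge0 //.
by rewrite -lee_fin fineK ?ge0_fin_numE ?H2_sqnorm_ge0.
Qed.

Lemma H2_coef_le a n : H2 w a -> (0 < n)%N ->
  sqmod (a n) <= w n * H2_norm w a ^+ 2.
Proof.
move=> ha n0; rewrite -ler_pdivrMl ?good_weight_gt0 // mulrC.
apply: le_trans (H2_partial_le n.+1 ha); rewrite big_nat_recr //= lerDr.
by rewrite big_seq sumr_ge0 // => i; rewrite mem_index_iota => /andP[i0 _]; exact: term_ge0.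
Qed.

Definition restrict (P : pred nat) a : dseries R := fun n => if P n then a n else 0.

Lemma H2_restrict (P : pred nat) a : H2 w a ->
  H2 w (restrict P a) /\ H2_norm w (restrict P a) <= H2_norm w a.
Proof.
move=> ha.
have [h1 h2] : H2 w (restrict P a) /\ H2_norm w (restrict P a) ^+ 2 <= H2_norm w a ^+ 2.
  apply: H2_bounded => N; apply: le_trans (H2_partial_le N ha).
  apply: ler_sum_nat => n /andP[n0 _]; rewrite /restrict; case: ifP => // _.
  by rewrite sqmod0 mul0r term_ge0.
by split=> //; rewrite -(@ler_pXn2r _ 2) ?nnegrE ?H2_norm_ge0.
Qed.

(** The partial sums defining the pairing are eventually constant. *)
Lemma H2_inner_polynomial a b N : (forall n, (N < n)%N -> a n = 0) ->
  H2_inner w a b = \sum_(1 <= n < N.+1) a n * Num.conj (b n) / (w n)%:C.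
Proof.
move=> aN; rewrite /H2_inner; apply: (@cvg_lim R[i]^o) => //.
apply: cvg_near_cst; exists N.+1 => // M /= NM.
rewrite (@big_cat_nat _ _ _ N.+1) //= [X in _ + X]big1_seq ?addr0 //.
by move=> i; rewrite mem_index_iota => /andP[_ /andP[Ni _]]; rewrite aN // !mul0r.
Qed.

End Norm.

Lemma sum_divisors (V : nmodType) (E : nat -> nat -> V) B n : (0 < n < B)%N ->
  \sum_(d <- divisors n) E d (n %/ d)%N =
  \sum_(1 <= j < B) \sum_(1 <= k < B | (j * k == n)%N) E j k.
Proof.
move=> /andP[n0 nB].
transitivity (\sum_(1 <= j < B | (j %| n)%N) E j (n %/ j)%N).
  rewrite -[RHS]big_filter; apply: perm_big; apply: uniq_perm.
  - exact: divisors_uniq.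
  - by rewrite filter_uniq ?iota_uniq.
  move=> d; rewrite -dvdn_divisors // mem_filter mem_index_iota.
  case: (boolP (d %| n)%N) => //= dn; rewrite (dvdn_gt0 n0 dn) /=.
  by rewrite (leq_ltn_trans (dvdn_leq n0 dn) nB).
rewrite big_mkcond; apply: eq_big_nat => j /andP[j0 _].
case: (boolP (j %| n)%N) => [/dvdnP[k E']|jn].
  rewrite E' mulnK //.
  rewrite (eq_bigl (fun i => i == k)); last by move=> i; rewrite mulnC eqn_pmul2r.
  rewrite big_nat1_eq; have k0 : (0 < k)%N by move: n0; rewrite E' muln_gt0 => /andP[].
  by rewrite k0 (leq_ltn_trans _ nB) // E' leq_pmulr.
by rewrite big1 // => k /eqP E'; move: jn; rewrite -E' dvdn_mulr.
Qed.

(** A quadratic polynomial without sign change has discriminant at most 0. *)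
Lemma quadratic_le (x y z : R) : 0 <= x -> 0 <= y ->
  (forall t, 2 * t * z <= t ^+ 2 * x + y) -> z ^+ 2 <= x * y.
Proof.
move=> x0 y0 h; have [x0'|x1] := eqVneq x 0.
  have [->|z0] := eqVneq z 0; first by rewrite expr0n /= mulr_ge0.
  have := h ((y + 1) / (2 * z)); rewrite x0' mulr0 add0r.
  have -> : 2 * ((y + 1) / (2 * z)) * z = y + 1 by field.
  by lra.
have xp : 0 < x by rewrite lt_def x1.
have := h (z / x).
have -> : 2 * (z / x) * z = 2 * z ^+ 2 / x by field.
have -> : (z / x) ^+ 2 * x = z ^+ 2 / x by field.
move=> h'; rewrite mulrC -ler_pdivrMr //; lra.
Qed.

Lemma cauchy_schwarz (I : Type) (s : seq I) (P : pred I) (x y : I -> R) :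
  (\sum_(i <- s | P i) x i * y i) ^+ 2 <=
  (\sum_(i <- s | P i) x i ^+ 2) * (\sum_(i <- s | P i) y i ^+ 2).
Proof.
apply: quadratic_le => [||t]; do ?by apply: sumr_ge0 => i _; exact: sqr_ge0.
rewrite !mulr_sumr -big_split; apply: ler_sum => i _ /=.
rewrite -subr_ge0 (_ : _ - _ = (t * x i - y i) ^+ 2) ?sqr_ge0 //; ring.
Qed.

Lemma normc_sum_le (I : Type) (s : seq I) (P : pred I) (F : I -> C) :
  ComplexField.Normc.normc (\sum_(i <- s | P i) F i) <=
  \sum_(i <- s | P i) ComplexField.Normc.normc (F i).
Proof.
elim/big_rec2: _ => [|i x y _ IH]; first by rewrite ComplexField.Normc.normc0.
by apply: le_trans (le_normcD _ _) _; rewrite lerD2l.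
Qed.

Lemma normc_ge0 (z : C) : 0 <= ComplexField.Normc.normc z.
Proof. by case: z => x y; exact: sqrtr_ge0. Qed.

Lemma sqmod_cauchy_schwarz (I : Type) (s : seq I) (P : pred I) (x y : I -> C) :
  sqmod (\sum_(i <- s | P i) x i * y i) <=
  (\sum_(i <- s | P i) sqmod (x i)) * (\sum_(i <- s | P i) sqmod (y i)).
Proof.
apply: le_trans (cauchy_schwarz _ _ _ _); rewrite lerXn2r ?nnegrE ?normc_ge0 //.
  by apply: sumr_ge0 => i _; rewrite mulr_ge0 ?normc_ge0.
apply: le_trans (normc_sum_le _ _ _) _.
by apply: ler_sum => i _; rewrite ComplexField.Normc.normcM.
Qed.

Lemma bounded_tail (x : nat -> R) (B : R) : (forall n, 0 <= x n) ->
  (forall N, \sum_(1 <= n < N) x n <= B) ->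
  forall e, 0 < e -> exists Z, forall Z' N, (Z <= Z')%N ->
    \sum_(Z' <= n < N) x n <= e.
Proof.
move=> x0 hB e e0.
pose S N := \sum_(1 <= n < N) x n.
have ndS : {homo S : n m / (n <= m)%N >-> n <= m} by exact: nondecreasing_sum.
have cS : cvgn S by apply: nondecreasing_is_cvgn => //; exists B => _ [N _ <-]; exact: hB.
have [Z _ hZ] : \forall n \near \oo, limn S - e < S n.
  by apply: cvgr_gt; [exact: cS | rewrite ltrBlDr ltrDl].
exists Z.+1 => Z' N ZZ'.
case: (leqP N Z') => NZ; first by rewrite big_geq // ltW.
have := hZ Z' (ltnW ZZ'); have := nondecreasing_cvgn_le ndS cS N.
have Z'0 : (0 < Z')%N by apply: leq_trans ZZ'.
rewrite /S (@big_cat_nat _ _ _ Z' 1 N) //=; last exact: ltnW.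
lra.
Qed.

End HilbertSpace.

(** * Hankel forms of Volterra symbols *)

Section VolterraToHankel.
Variable R : realType.
Local Notation C := R[i].
Implicit Types (f h : dseries R).

(** The properties shared by H2_w and its subspace of series without constant
    term on which the whole argument rests. *)
Definition admissible (w : nat -> R) (Y : set (dseries R)) : Prop :=
  [/\ forall f, Y f -> H2 w f,
      forall f (P : pred nat), Y f -> Y (restrict P f) &
      forall f, H2 w f -> f 1%N = 0 -> Y f].

Lemma admissible_H2 w : good_weight w -> admissible w (H2 w).
Proof. by move=> gw; split=> // f P hf; have [] := H2_restrict gw P hf. Qed.

Lemma admissible_H2_0 w : good_weight w -> admissible w (H2_0 w).
Proof.
move=> gw; split=> [f []//|f P [hf f1]|f hf f1]; split=> //.
  by have [] := H2_restrict gw P hf.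
by rewrite /restrict f1 if_same.
Qed.

Definition dlog (g : dseries R) : dseries R := fun n => g n * (ln (n%:R : R))%:C.

Lemma dlog1 g : dlog g 1%N = 0.
Proof. by rewrite /dlog ln1 mulr0. Qed.

Lemma volterraE g f n : (0 < n)%N ->
  volterra g f n = ((ln (n%:R : R))^-1)%:C * dmul f (dlog g) n.
Proof.
move=> n0; rewrite /volterra /dmul /dlog; congr (_ * _).
rewrite big_mkcond big_seq [RHS]big_seq; apply: eq_bigr => k.
rewrite -dvdn_divisors // => kn; rewrite mulrA; case: ifP => // /negbT.
rewrite -leqNgt => nk; have -> : k = n by apply/eqP; rewrite eqn_leq nk dvdn_leq.
by rewrite divnn n0 ln1 mulr0.
Qed.

Variables (w : nat -> R) (Y : set (dseries R)) (g : dseries R) (M : R).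
Hypotheses (gw : good_weight w) (adY : admissible w Y) (M0 : 0 <= M)
  (hT : forall f, Y f -> Y (volterra g f) /\ H2_norm w (volterra g f) <= M * H2_norm w f).

Let w0 n : (0 < n)%N -> 0 < w n. Proof. exact: good_weight_gt0. Qed.
Let lnp n : (1 < n)%N -> 0 < ln (n%:R : R). Proof. by move=> ?; rewrite ln_gt0 ?ltr1n. Qed.

(** The image of 2^-s under T_g has at 2 n the coefficient
    g_n log n / log (2 n), for n > 1 at least half of g_n in modulus. The series
    2^-s is used instead of 1 because it belongs to both spaces. *)
Lemma symbol_square_summable : exists B, forall N, \sum_(1 <= n < N) sqmod (g n) / w n <= B.
Proof.
pose e2 : dseries R := fun n => if n == 2%N then 1 else 0.
have [_ _ sub] := adY.
have Ye2 : Y e2.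
  apply: sub => //; have [|//] := @H2_bounded _ w gw e2 ((w 2%N)^-1).
  move=> N; rewrite (eq_bigr (fun n => if n == 2%N then (w n)^-1 else 0)); last first.
    by move=> n _; rewrite /e2; case: ifP => _; rewrite ?sqmod0 ?mul0r // (sqmod_real 1) expr1n mul1r.
  rewrite -big_mkcond big_nat1_eq; case: ifP => // _.
  by rewrite invr_ge0 ltW ?w0.
have [YT _] := hT Ye2; have hTH : H2 w (volterra g e2) by case: adY => + _ _; apply.
have [_ [Cw wC] _] := gw.
have Cw0 : 0 <= Cw.
  have /andP[h1 h2] := wC 2%N 1%N isT isT.
  have := le_trans h1 h2; have := w0 (ltnSn 0) => p h.
  by rewrite -(pmulr_lge0 _ p); apply: le_trans h; exact: ltW.
pose B := H2_norm w (volterra g e2) ^+ 2.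
have B0 : 0 <= B by exact: sqr_ge0.
exists (sqmod (g 1%N) / w 1%N + 4 * Cw * B) => N.
have E n : (1 < n)%N -> sqmod (g n) / w n <= 4 * Cw * (sqmod (volterra g e2 (2 * n)%N) / w (2 * n)%N).
  move=> n1; have n0 := ltnW n1; have n20 : (0 < 2 * n)%N by rewrite muln_gt0.
  rewrite volterraE // /dmul (eq_bigr (fun d => if d == 2%N then dlog g n else 0)); last first.
    move=> d _; rewrite /e2; case: eqP => [->|_]; last by rewrite mul0r.
    by rewrite mul1r mulKn.
  rewrite (bigD1_seq 2%N) ?divisors_uniq -?dvdn_divisors ?dvdn_mulr //=.
  rewrite big1 ?addr0; last by move=> d /negbTE ->.
  rewrite /dlog !sqmodM !sqmod_real.
  have l1 := lnp n1; have l2 : 0 < ln ((2 * n)%:R : R) by apply: lnp; lia.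
  have ll : ln ((2 * n)%:R : R) <= 2 * ln n%:R.
    rewrite natrM lnM ?posrE ?ltr0n // [2 * _]mulr_natl mulr2n lerD2r.
    rewrite ler_ln ?posrE ?ltr0n //.
    by have : 2%:R <= n%:R :> R by rewrite ler_nat.
  have /andP[wl wu] := wC 2%N n isT n0.
  have wn := w0 n0; have w2n := w0 n20.
  rewrite ler_pdivrMr //.
  have sg := sqmod_ge0 (g n).
  set a := ln (n%:R : R) in l1 ll *; set b := ln _ in l2 ll *.
  have -> : 4 * Cw * (b^-1 ^+ 2 * (sqmod (g n) * a ^+ 2) / w (2 * n)%N) * w n =
    sqmod (g n) * ((2 * a / b) ^+ 2 * (Cw * w n / w (2 * n)%N)).
    by field; rewrite !gt_eqF.
  rewrite -[X in X <= _]mulr1 ler_wpM2l // -[X in X <= _]mulr1 ler_pM //.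
    by rewrite expr_ge1 // ?divr_ge0 ?mulr_ge0 ?(ltW l1) ?(ltW l2) // ler_pdivlMr // mul1r.
  by rewrite ler_pdivlMr // mul1r.
have [N1|N1] := leqP N 1.
  have W : 0 <= sqmod (g 1%N) / w 1%N by rewrite divr_ge0 ?sqmod_ge0 // ltW ?w0.
  rewrite big_geq //; apply: addr_ge0 => //; apply: mulr_ge0 => //.
  exact: mulr_ge0.
rewrite big_ltn // lerD2l.
apply: (@le_trans _ _ (\sum_(2 <= n < N) 4 * Cw * (sqmod (volterra g e2 (2 * n)%N) / w (2 * n)%N))).
  by apply: ler_sum_nat => n /andP[n1 _]; apply: E.
rewrite -mulr_sumr ler_wpM2l ?mulr_ge0 //.
apply: le_trans (H2_partial_le gw (2 * N) hTH).
apply: (@ler_sum_inj _ _ _ _ _ (fun n => 2 * n)%N (fun n => sqmod (volterra g e2 n) / w n)).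
- exact: iota_uniq.
- exact: iota_uniq.
- by move=> n; rewrite !mem_index_iota => /andP[n1 nN]; rewrite ltn_mul2l nN /= muln_gt0 /= ltnW.
- by move=> n n' _ _ /eqP; rewrite eqn_pmul2l // => /eqP.
- move=> n; rewrite mem_index_iota => /andP[n0 _].
  by rewrite divr_ge0 ?sqmod_ge0 // ltW ?w0.
Qed.

Let V n : R := ((ln (n%:R : R) ^+ 2)^-1) * (w n)^-1.

Let hypV : hyponormal V.
Proof.
have [_ _ hw] := gw.
apply: hyponormal_ext (hypo_mult_ln2 (hw _ (@hyponormal1 R))) => n n1.
by rewrite mulr1.
Qed.

Let V0 n : (0 < n)%N -> 0 <= V n.
Proof. by move=> n0; rewrite mulr_ge0 ?invr_ge0 ?sqr_ge0 // ltW ?w0. Qed.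

Let V_le k l : (0 < k)%N -> (1 < l)%N -> V (k * l)%N <= V l.
Proof.
move=> k0 l1; have l0 := ltnW l1; have kl1 : (1 < k * l)%N.
  by apply: leq_trans l1 _; rewrite leq_pmull.
have p1 := lnp l1; have p2 := lnp kl1.
rewrite /V ler_pM ?invr_ge0 ?sqr_ge0 ?(ltW (w0 (ltnW kl1))) //.
  rewrite lef_pV2 ?posrE ?exprn_gt0 // lerXn2r ?nnegrE ?(ltW p1) ?(ltW p2) //.
  by rewrite ler_ln ?posrE ?ltr0n ?(ltnW kl1) // ler_nat leq_pmull.
by rewrite lef_pV2 ?posrE ?w0 ?(ltnW kl1) // good_weight_mulr.
Qed.

Let V_dlog n : (1 < n)%N -> V n * sqmod (dlog g n) = sqmod (g n) / w n.
Proof.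
move=> n1; rewrite /V /dlog sqmodM sqmod_real.
have := lnp n1; have := w0 (ltnW n1) => p1 p2; field.
by rewrite !gt_eqF.
Qed.

(** The product form of the hyponormal inequality. Replacing a by t conj(S) a,
    with S the sum on the left and t real, gives a quadratic inequality in t. *)
Lemma hyponormal_bound X Z (a h G : dseries R) : a 1%N = 0 -> G 1%N = 0 ->
  (X ^ 2 <= Z)%N ->
  sqmod (\sum_(1 <= j < X) \sum_(1 <= k < X)
     a j * h k * Num.conj (G (j * k)%N) * (V (j * k)%N)%:C)
  <= (\sum_(1 <= j < X) V j * sqmod (a j)) *
     (\sum_(1 <= n < Z ^ 2) V n *
        sqmod (\sum_(1 <= k < X) \sum_(1 <= l < Z | (k * l == n)%N) h k * G l)).
Proof.
move=> a1 G1 XZ; set S := \sum_(_ <= j < X) _; set A := \sum_(_ <= j < X) _.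
set Q := \sum_(_ <= n < _) _.
have A0 : 0 <= A.
  by rewrite /A big_seq sumr_ge0 // => i; rewrite mem_index_iota => /andP[i0 _]; rewrite mulr_ge0 ?V0 ?sqmod_ge0.
have Q0 : 0 <= Q.
  by rewrite /Q big_seq sumr_ge0 // => i; rewrite mem_index_iota => /andP[i0 _]; rewrite mulr_ge0 ?V0 ?sqmod_ge0.
have XZ' : (X <= Z)%N.
  by apply: leq_trans XZ; case: (X) => // x; rewrite expnS expn1 leq_pmulr.
have key t : 2 * t * sqmod S <= t ^+ 2 * (sqmod S * A) + Q.
  have := @hypV Z (fun j => if (j < X)%N then a j * ((Num.conj S : C) * t%:C) else 0)
    (fun k => if (k < X)%N then h k else 0) G.
  rewrite a1 mul0r if_same G1 => /(_ erefl erefl).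
  have cut (F : nat -> R) : \sum_(1 <= j < Z) (if (j < X)%N then F j else 0) = \sum_(1 <= j < X) F j.
    by rewrite [RHS](big_nat_widen _ _ _ _ _ XZ') [RHS]big_mkcond.
  have cutC (F : nat -> C) : \sum_(1 <= j < Z) (if (j < X)%N then F j else 0) = \sum_(1 <= j < X) F j.
    by rewrite [RHS](big_nat_widen _ _ _ _ _ XZ') [RHS]big_mkcond.
  rewrite (eq_bigr (fun j => if (j < X)%N then \sum_(1 <= k < X) (a j * h k * Num.conj (G (j * k)%N) * (V (j * k)%N)%:C) * ((Num.conj S : C) * t%:C) else 0)); last first.
    move=> j _; case: ifP => jX; last first.
      by apply: big1 => k _; apply: big1 => l _; rewrite !mul0r.
    rewrite -cutC; apply: eq_big_nat => k /andP[k0 _]; case: ifP => kX; last first.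
      by apply: big1 => l _; rewrite mulr0 !mul0r.
    rewrite (eq_bigl (fun l => l == j * k)%N); last by move=> l; rewrite eq_sym.
    rewrite big_nat1_eq; case: ifP => [_|]; first by ring.
    move/negbT; rewrite negb_and -leqNgt leqn0 muln_eq0 -leqNgt.
    case/orP => [/orP[/eqP j0|/eqP k00]|h1]; last first.
    - have := leq_trans XZ h1; rewrite expnS expn1 => h2.
      by have := ltn_mul jX kX; rewrite ltnNge h2.
    - by rewrite k00 in k0.
    - by rewrite j0 /V ln0 // expr0n invr0 mul0r mulr0 mul0r.
  rewrite cutC.
  have -> : \sum_(1 <= j < X) \sum_(1 <= k < X)
     a j * h k * Num.conj (G (j * k)%N) * (V (j * k)%N)%:C * ((Num.conj S : C) * t%:C) =
     S * (Num.conj S : C) * t%:C.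
    rewrite -mulrA /S mulr_suml; apply: eq_bigr => j _; rewrite mulr_suml.
    by apply: eq_bigr => k _; rewrite -/S; ring.
  rewrite ReZ Re_sqmod => H.
  have -> : 2 * t * sqmod S = 2 * (sqmod S * t) by ring.
  apply: le_trans H _; rewrite lerD //.
    rewrite le_eqVlt; apply/orP; left; apply/eqP.
    rewrite (eq_bigr (fun j => if (j < X)%N then V j * sqmod (a j) * (sqmod S * t ^+ 2) else 0)).
      by rewrite cut -mulr_suml -/A; ring.
    move=> j _; case: ifP => _; last by rewrite sqmod0 mulr0.
    by rewrite !sqmodM sqmod_conj sqmod_real; ring.
  rewrite le_eqVlt; apply/orP; left; apply/eqP.
  apply: eq_bigr => n _; congr (_ * sqmod _); rewrite -cutC.
  apply: eq_bigr => k _; case: ifP => // _.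
  by apply: big1 => l _; rewrite mul0r.
have := quadratic_le (mulr_ge0 (sqmod_ge0 S) A0) Q0 key.
have [->|S0] := eqVneq (sqmod S) 0; first by rewrite mulr_ge0.
have Sp : 0 < sqmod S by rewrite lt_def S0 sqmod_ge0.
by rewrite -mulrA expr2 ler_pM2l.
Qed.

Lemma sqmod_sum_single k n Z (G : dseries R) : (0 < k)%N ->
  sqmod (\sum_(1 <= l < Z | (k * l == n)%N) G l) =
  \sum_(1 <= l < Z | (k * l == n)%N) sqmod (G l).
Proof.
move=> k0; case: (boolP (k %| n)%N) => [/dvdnP[q ->]|kn].
  have e l : (k * l == q * k)%N = (l == q) by rewrite mulnC eqn_pmul2r.
  rewrite (eq_bigl _ _ e) (eq_bigl (fun l => l == q) (fun l => sqmod (G l)) e) !big_nat1_eq.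
  by case: ifP => // _; rewrite sqmod0.
by rewrite !big1 ?sqmod0 // => l /eqP E; move: kn; rewrite -E dvdn_mulr.
Qed.

(** Hyponormality concerns finite sequences, so Lg has to be cut at Z. Below Z the
    coefficients of h times the cut Lg are those of h . Lg, that is, of T_g h up
    to the factor log n. Those beyond Z are small in norm because g is square
    summable and h is finite. *)
Lemma multiplier_tail X (h : dseries R) (e : R) : 0 < e -> Y h ->
  (forall n, (X <= n)%N -> h n = 0) ->
  exists2 Z, (X ^ 2 <= Z)%N &
  \sum_(1 <= n < Z ^ 2) V n *
     sqmod (\sum_(1 <= k < X) \sum_(1 <= l < Z | (k * l == n)%N) h k * dlog g l)
  <= (M * H2_norm w h) ^+ 2 + e.
Proof.
move=> e0 Yh hX.
pose H := \sum_(1 <= k < X) sqmod (h k).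
have H0 : 0 <= H by apply: sumr_ge0 => k _; exact: sqmod_ge0.
pose x n : R := if (0 < n)%N then sqmod (g n) / w n else 0.
have x0 n : 0 <= x n.
  by rewrite /x; case: ifP => // n0; rewrite divr_ge0 ?sqmod_ge0 // ltW ?w0.
have [B hB] := symbol_square_summable.
have hB' N : \sum_(1 <= n < N) x n <= B.
  apply: le_trans (hB N); rewrite le_eqVlt; apply/orP; left; apply/eqP.
  by apply: eq_big_nat => n /andP[n0 _]; rewrite /x n0.
have c0 : 0 < H * X%:R + 1 by rewrite ltr_wpDl // mulr_ge0.
have [Z1 hZ1] := bounded_tail x0 hB' (divr_gt0 e0 c0).
pose Z2 := maxn Z1 X; pose Z := (X * Z2)%N.
have XZ : (X ^ 2 <= Z)%N by rewrite /Z expnS expn1 leq_mul2l leq_maxr orbT.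
have XZ' : (X <= Z)%N.
  by apply: leq_trans XZ; case: (X) => // y; rewrite expnS expn1 leq_pmulr.
exists Z => //.
have ZZ : (Z <= Z ^ 2)%N.
  by case: (Z) => // y; rewrite expnS expn1 leq_pmulr.
have [Z0|Z0] := posnP Z.
  by rewrite Z0 big_geq // addr_ge0 ?sqr_ge0 // ltW.
have /andP[X0 Z20] : (0 < X)%N && (0 < Z2)%N by rewrite -muln_gt0.
have Z2Z : (Z2 <= Z)%N by rewrite leq_pmull.
rewrite (@big_cat_nat _ _ _ Z) //=; apply: lerD.
  have [YT le] := hT Yh; have hTH : H2 w (volterra g h) by case: adY => + _ _; apply.
  apply: (@le_trans _ _ (H2_norm w (volterra g h) ^+ 2)); last first.
    by rewrite lerXn2r ?nnegrE ?H2_norm_ge0 // mulr_ge0 ?H2_norm_ge0.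
  apply: le_trans (H2_partial_le gw Z hTH); apply: ler_sum_nat => n /andP[n0 nZ].
  rewrite volterraE // sqmodM sqmod_real /V -exprVn.
  rewrite /dmul (@sum_divisors _ (fun k l => h k * dlog g l) Z) ?n0 ?nZ //.
  rewrite [X in sqmod X](_ : _ = \sum_(1 <= j < Z) \sum_(1 <= k < Z | (j * k)%N == n) h j * dlog g k).
    by rewrite mulrAC.
  rewrite [RHS](@big_cat_nat _ _ _ X) //=.
  rewrite [X in _ = _ + X]big1_seq ?addr0 // => k; rewrite mem_index_iota => /andP[_ /andP[Xk _]].
  by rewrite big1 // => l _; rewrite hX // mul0r.
apply: (@le_trans _ _ (\sum_(Z <= n < Z ^ 2) \sum_(1 <= k < X) \sum_(1 <= l < Z | (k * l == n)%N) H * x l)).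
  apply: ler_sum_nat => n /andP[Zn _].
  have n0 : (0 < n)%N by apply: leq_trans Zn.
  rewrite (eq_bigr (fun k => h k * \sum_(1 <= l < Z | (k * l)%N == n) dlog g l)); last first.
    by move=> k _; rewrite mulr_sumr.
  apply: le_trans (ler_wpM2l (V0 n0) (sqmod_cauchy_schwarz _ _ _ _)) _.
  rewrite mulrCA mulr_sumr mulr_sumr; apply: ler_sum_nat => k /andP[k0 kX].
  rewrite sqmod_sum_single // !mulr_sumr.
  rewrite big_nat_cond [leRHS]big_nat_cond; apply: ler_sum => l /andP[/andP[l0 _] /eqP E].
  rewrite ler_wpM2l // /x l0.
  have [l1|l1] := leqP l 1.
    have -> : l = 1%N by apply/eqP; rewrite eqn_leq l1.
    by rewrite dlog1 sqmod0 mulr0 divr_ge0 ?sqmod_ge0 // ltW ?w0.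
  rewrite -V_dlog // ler_wpM2r ?sqmod_ge0 // -E; exact: V_le.
rewrite exchange_big_nat /=.
apply: (@le_trans _ _ (\sum_(1 <= k < X) H * \sum_(Z2 <= l < Z) x l)).
  apply: ler_sum_nat => k /andP[k0 kX].
  under eq_bigr do rewrite big_mkcond /=.
  rewrite exchange_big_nat /= mulr_sumr.
  rewrite (@big_cat_nat _ _ _ Z2 1 Z) //=.
  rewrite big_nat big1 ?add0r; last first.
    move=> l /andP[l0 lZ]; rewrite -big_mkcond big_nat_cond big1 // => n /andP[/andP[Zn _] /eqP E].
    have : (k * l < Z)%N by rewrite /Z ltn_mul.
    by rewrite E ltnNge Zn.
  apply: ler_sum => l _; rewrite -big_mkcond.
  rewrite (eq_bigl (fun n => n == k * l)%N); last by move=> n; rewrite eq_sym.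
  by rewrite big_nat1_eq; case: ifP => // _; rewrite mulr_ge0.
rewrite sumr_const_nat -mulr_natr -mulrA.
have := hZ1 Z2 Z (leq_maxl _ _); set T := \sum_(_ <= l < _) _; rewrite ler_pdivlMr // => hT'.
have T0 : 0 <= T by apply: sumr_ge0.
have : (X - 1)%:R <= X%:R :> R by rewrite ler_nat leq_subr.
move/(ler_wpM2l (mulr_ge0 H0 T0)); move: hT' T0; lra.
Qed.

(** The hyponormal inequality for a = Lf: the norm of Lf with the weights V is at
    most that of f, and the norm of h . Lg is that of T_g h. *)
Lemma hankel_half X (f h : dseries R) : H2 w f -> Y h ->
  (forall n, (X <= n)%N -> h n = 0) ->
  ComplexField.Normc.normc (\sum_(1 <= j < X) \sum_(1 <= k < X)
     dlog f j * h k * Num.conj (dlog g (j * k)%N) * (V (j * k)%N)%:C)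
  <= M * H2_norm w f * H2_norm w h.
Proof.
move=> hf Yh hX; set S := \sum_(_ <= j < X) _.
have b0 : 0 <= M * H2_norm w h by rewrite mulr_ge0 ?H2_norm_ge0.
have a0 := H2_norm_ge0 w f.
rewrite -(@ler_pXn2r _ 2) ?nnegrE ?normc_ge0 //; last by rewrite mulr_ge0 ?H2_norm_ge0 ?mulr_ge0.
rewrite mulrAC exprMn mulrC -/(sqmod S); apply/ler_addgt0Pl => e e0.
set a := H2_norm w f in a0 *; set b := M * _ in b0 *.
have c0 : 0 < a ^+ 2 + 1 by rewrite ltr_wpDl ?sqr_ge0.
have [Z XZ hZ] := multiplier_tail (divr_gt0 e0 c0) Yh hX.
apply: le_trans (hyponormal_bound h (dlog1 f) (dlog1 g) XZ) _.
have A_le : \sum_(1 <= j < X) V j * sqmod (dlog f j) <= a ^+ 2.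
  apply: le_trans (H2_partial_le gw X hf); apply: ler_sum_nat => j /andP[j0 _].
  have [j1|j1] := leqP j 1.
    have -> : j = 1%N by apply/eqP; rewrite eqn_leq j1.
    by rewrite dlog1 sqmod0 mulr0 divr_ge0 ?sqmod_ge0 // ltW ?w0.
  rewrite /V /dlog sqmodM sqmod_real le_eqVlt; apply/orP; left; apply/eqP.
  have := lnp j1; have := w0 (ltnW j1) => p1 p2; field.
  by rewrite !gt_eqF.
apply: (@le_trans _ _ (a ^+ 2 * (b ^+ 2 + e / (a ^+ 2 + 1)))).
  apply: ler_pM => //; rewrite big_seq sumr_ge0 // => i; rewrite mem_index_iota => /andP[i0 _];
  by rewrite mulr_ge0 ?V0 ?sqmod_ge0.
rewrite mulrDr addrC lerD2r mulrCA ger_pMr // ler_pdivrMr // mul1r lerDl //.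
Qed.

(** The Leibniz rule log (j k) = log j + log k splits the form into two sums
    bounded by [hankel_half] and the term at j = k = 1. *)
Lemma hankel_polynomial X (f h : dseries R) : Y f -> Y h ->
  (forall n, (X <= n)%N -> f n = 0) -> (forall n, (X <= n)%N -> h n = 0) ->
  ComplexField.Normc.normc (\sum_(1 <= j < X) \sum_(1 <= k < X)
     f j * h k * (Num.conj (g (j * k)%N) / (w (j * k)%N)%:C))
  <= (2 * M + ComplexField.Normc.normc (g 1%N)) * (H2_norm w f * H2_norm w h).
Proof.
move=> Yf Yh fX hX; have [sub _ _] := adY.
pose s1 := \sum_(1 <= j < X) \sum_(1 <= k < X)
     dlog f j * h k * Num.conj (dlog g (j * k)%N) * (V (j * k)%N)%:C.
pose s2 := \sum_(1 <= j < X) \sum_(1 <= k < X)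
     dlog h j * f k * Num.conj (dlog g (j * k)%N) * (V (j * k)%N)%:C.
pose s3 : C := \sum_(1 <= j < X) \sum_(1 <= k < X | (j * k == 1)%N)
     f j * h k * (Num.conj (g (j * k)%N) / (w (j * k)%N)%:C).
have -> : \sum_(1 <= j < X) \sum_(1 <= k < X)
     f j * h k * (Num.conj (g (j * k)%N) / (w (j * k)%N)%:C) = s1 + s2 + s3.
  have -> : s2 = \sum_(1 <= j < X) \sum_(1 <= k < X)
     dlog h k * f j * Num.conj (dlog g (j * k)%N) * (V (j * k)%N)%:C.
    rewrite /s2 exchange_big_nat; apply: eq_bigr => j _.
    by apply: eq_bigr => k _; rewrite mulnC.
  rewrite -!big_split; apply: eq_big_nat => j /andP[j0 jX] /=.
  rewrite [X in _ + X]big_mkcond -!big_split; apply: eq_big_nat => k /andP[k0 kX] /=.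
  have [e1|n1] := eqVneq (j * k)%N 1%N.
    by rewrite e1 dlog1 rmorph0 !mulr0 !mul0r !add0r.
  have jk1 : (1 < j * k)%N by rewrite ltn_neqAle eq_sym n1 muln_gt0 j0.
  rewrite addr0 /dlog conjM conj_real.
  have L := lnp jk1; have W := w0 (ltnW jk1).
  have Lsplit : ln ((j * k)%:R : R) = ln j%:R + ln k%:R.
    by rewrite natrM lnM ?posrE ?ltr0n.
  have -> : (w (j * k)%N)%:C^-1 = (V (j * k)%N * ln ((j * k)%:R : R) * (ln j%:R + ln k%:R))%:C :> C.
    rewrite -Lsplit -fmorphV; congr (_%:C); rewrite /V; field.
    by rewrite !gt_eqF.
  rewrite !real_complexM [(_ + _)%:C]rmorphD /=; ring.
have W1 : w 1%N = 1 by case: gw.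
have s1_le := hankel_half (sub _ Yf) Yh hX.
have s2_le := hankel_half (sub _ Yh) Yf fX.
have s3_le : ComplexField.Normc.normc s3 <= ComplexField.Normc.normc (g 1%N) * (H2_norm w f * H2_norm w h).
  have c1 a : H2 w a -> ComplexField.Normc.normc (a 1%N) <= H2_norm w a.
    move=> ha; rewrite -(@ler_pXn2r _ 2) ?nnegrE ?normc_ge0 ?H2_norm_ge0 //.
    by have := H2_coef_le gw ha (ltnSn 0); rewrite W1 mul1r.
  have -> : s3 = if (1 < X)%N then f 1%N * h 1%N * Num.conj (g 1%N) else 0.
    have [X1|X1] := ltnP 1 X; last by rewrite /s3 big_geq.
    rewrite /s3 big_ltn // [X in _ + X]big1_seq ?addr0; last first.
      move=> j; rewrite mem_index_iota => /andP[_ /andP[j1 _]].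
      by apply: big1 => k; rewrite muln_eq1 => /andP[/eqP e]; rewrite e in j1.
    rewrite (eq_bigl (fun k => k == 1)%N); last by move=> k; rewrite mul1n.
    by rewrite big_nat1_eq X1 /= muln1 W1 divr1.
  case: ifP => _; last by rewrite ComplexField.Normc.normc0 !mulr_ge0 ?normc_ge0 ?H2_norm_ge0.
  rewrite !ComplexField.Normc.normcM mulrC.
  rewrite (_ : ComplexField.Normc.normc (Num.conj (g 1%N) : C) = ComplexField.Normc.normc (g 1%N)); last first.
    by case: (g 1%N) => u v /=; rewrite sqrrN.
  by apply: ler_wpM2l; rewrite ?normc_ge0 // ler_pM ?normc_ge0 //; apply: c1; apply: sub.
apply: le_trans (le_normcD _ _) _.
apply: (@le_trans _ _ (M * H2_norm w f * H2_norm w h + M * H2_norm w h * H2_norm w f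
   + ComplexField.Normc.normc (g 1%N) * (H2_norm w f * H2_norm w h))).
  by apply: lerD => //; apply: le_trans (le_normcD _ _) _; apply: lerD.
rewrite le_eqVlt; apply/orP; left; apply/eqP; ring.
Qed.

End VolterraToHankel.

(** * Fejer means of products *)

Section Grading.

(** The completely additive function with value kappa p at each prime p. *)
Definition add_fun (kappa : nat -> nat) (n : nat) : nat :=
  (\sum_(0 <= p < n.+1) kappa p * logn p n)%N.

Lemma add_funE kappa n N : (n < N)%N ->
  add_fun kappa n = (\sum_(0 <= p < N) kappa p * logn p n)%N.
Proof.
move=> nN; rewrite [RHS](big_cat_nat _ nN) //= [X in (_ + X)%N]big1_seq ?addn0 //.
move=> p /=; rewrite mem_index_iota => /andP[np _]; rewrite lognE.
case: n {nN} np => [|n] np; first by rewrite andbF muln0.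
by rewrite (@gtnNdvd n.+1 p) // !andbF muln0.
Qed.

Lemma add_funM kappa m n : (0 < m)%N -> (0 < n)%N ->
  add_fun kappa (m * n) = (add_fun kappa m + add_fun kappa n)%N.
Proof.
move=> m0 n0; have hm : (m < (m * n).+1)%N by rewrite ltnS leq_pmulr.
have hn : (n < (m * n).+1)%N by rewrite ltnS leq_pmull.
rewrite (add_funE kappa hm) (add_funE kappa hn) -big_split /add_fun.
by apply: eq_bigr => p _; rewrite lognM // mulnDr.
Qed.

Lemma add_fun1 kappa : add_fun kappa 1 = 0%N.
Proof. by rewrite /add_fun big1 // => p _; rewrite logn1 muln0. Qed.

Lemma add_fun_prime kappa p : prime p -> add_fun kappa p = kappa p.
Proof.
move=> pp; rewrite /add_fun (bigD1_seq p) ?iota_uniq ?mem_index_iota //=.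
rewrite logn_prime // eqxx muln1 big1 ?addn0 // => q /negbTE qp.
by rewrite logn_prime // qp muln0.
Qed.

(** The sum of the prime factors. An additive grading with finite sublevel sets
    is what the averaging below needs; the number of prime factors has
    infinite ones. *)
Definition grade := add_fun id.

Lemma le_exp_grade n : (0 < n)%N -> (n <= 2 ^ grade n)%N.
Proof.
move: n; apply: (@prime_ind (fun n => n <= 2 ^ grade n)%N) => [|p n pp n0 IH].
  by rewrite expn_gt0.
rewrite /grade add_funM ?(prime_gt0 pp) // (add_fun_prime _ pp) expnD leq_mul //.
exact: ltnW (ltn_expl _ _).
Qed.

(** The Fejer weight of a + b counts the x with a <= x and b < D - x, which
    separates the two variables. *)
Lemma card_splits D a b :
  (\sum_(0 <= x < D | (a <= x) && (x + b < D)) 1 = D - (a + b))%N.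
Proof.
transitivity (\sum_(a <= x < D - b) 1)%N; last first.
  by rewrite sum_nat_const_nat muln1 subnDA subnAC.
rewrite [RHS](big_nat_widen _ _ D) ?leq_subr // [RHS](big_nat_widenl _ 0) //.
by apply: eq_bigl => x /=; rewrite andbC ltn_subRL addnC.
Qed.

End Grading.

Section Averaging.
Variable R : realType.
Local Notation C := R[i].
Implicit Types (f h : dseries R).
Local Notation normc := ComplexField.Normc.normc.

Variables (w : nat -> R) (Y : set (dseries R)) (g : dseries R) (K : R).
Hypotheses (gw : good_weight w) (adY : admissible w Y) (K0 : 0 <= K).
Let gam n : C := Num.conj (g n) / (w n)%:C.
Hypothesis hankel : forall X f h, Y f -> Y h ->
  (forall n, (X <= n)%N -> f n = 0) -> (forall n, (X <= n)%N -> h n = 0) ->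
  normc (\sum_(1 <= j < X) \sum_(1 <= k < X) f j * h k * gam (j * k)%N)
  <= K * (H2_norm w f * H2_norm w h).

(** Inserting the count of [card_splits] for the Fejer weight turns the mean into a
    sum over x of the Hankel form at truncations of f and h, whose norms are at
    most those of f and h. *)
Lemma fejer_mean D f h : Y f -> Y h ->
  normc (\sum_(1 <= n < 2 ^ D) (D - grade n)%N%:R * gam n * dmul f h n)
  <= D%:R * (K * (H2_norm w f * H2_norm w h)).
Proof.
move=> Yf Yh; have [sub res _] := adY; set B := (2 ^ D)%N.
have gB n : (B <= n)%N -> (D <= grade n)%N.
  case: n => [|n] Bn; first by move: Bn; rewrite leqn0 expn_eq0.
  by rewrite -(@leq_exp2l 2) //; apply: leq_trans Bn (le_exp_grade _).
pose F x j := restrict (fun n => (0 < n) && (n < B) && (grade n <= x))%N f j.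
pose H x j := restrict (fun n => (0 < n) && (n < B) && (x + grade n < D))%N h j.
have -> : \sum_(1 <= n < B) (D - grade n)%N%:R * gam n * dmul f h n =
    \sum_(0 <= x < D) \sum_(1 <= j < B) \sum_(1 <= k < B) F x j * H x k * gam (j * k)%N.
  transitivity (\sum_(1 <= j < B) \sum_(1 <= k < B)
      (D - (grade j + grade k))%N%:R * (f j * h k * gam (j * k)%N)).
    transitivity (\sum_(1 <= n < B) \sum_(1 <= j < B) \sum_(1 <= k < B)
        (if (j * k == n)%N then (D - (grade j + grade k))%N%:R * (f j * h k * gam (j * k)%N) else 0)).
      apply: eq_big_nat => n hn; rewrite /dmul (sum_divisors (fun j k => f j * h k) hn) mulr_sumr.
      apply: eq_big_nat => j /andP[j0 _]; rewrite mulr_sumr big_mkcond.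
      apply: eq_big_nat => k /andP[k0 _]; case: eqP => // <-.
      by rewrite /grade add_funM //; ring.
    rewrite exchange_big_nat; apply: eq_big_nat => j /andP[j0 _].
    rewrite exchange_big_nat; apply: eq_big_nat => k /andP[k0 _].
    rewrite -big_mkcond (eq_bigl (fun n => n == j * k)%N); last by move=> n; rewrite eq_sym.
    rewrite big_nat1_eq muln_gt0 j0 k0 /=; case: ltnP => // Bjk.
    have := gB _ Bjk; rewrite /grade add_funM // -subn_eq0 => /eqP ->.
    by rewrite mul0r.
  rewrite [RHS]exchange_big_nat; apply: eq_big_nat => j /andP[j0 jB].
  rewrite [RHS]exchange_big_nat; apply: eq_big_nat => k /andP[k0 kB].
  rewrite -(card_splits D) natr_sum mulr_suml big_mkcond; apply: eq_bigr => x _.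
  rewrite /F /H /restrict j0 jB k0 kB /=.
  by case: (grade j <= x)%N; case: (x + grade k < D)%N; rewrite /= ?mul1r ?mul0r ?mulr0 ?mul0r.
apply: le_trans (normc_sum_le _ _ _) _.
apply: (@le_trans _ _ (\sum_(0 <= x < D) K * (H2_norm w f * H2_norm w h))); last first.
  by rewrite sumr_const_nat subn0 [leRHS]mulr_natl.
apply: ler_sum => x _.
apply: (@le_trans _ _ (K * (H2_norm w (F x) * H2_norm w (H x)))).
  apply: hankel; rewrite ?/F ?/H; [exact: res|exact: res| |].
  - by move=> n Bn; rewrite /restrict [(n < B)%N]ltnNge Bn andbF.
  - by move=> n Bn; rewrite /restrict [(n < B)%N]ltnNge Bn andbF.
rewrite ler_wpM2l // ler_pM ?H2_norm_ge0 //.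
- by have [_] := H2_restrict gw (fun n => (0 < n) && (n < B) && (grade n <= x))%N (sub _ Yf).
- by have [_] := H2_restrict gw (fun n => (0 < n) && (n < B) && (x + grade n < D))%N (sub _ Yh).
Qed.

(** D times the pairing differs from D times the Fejer mean by
    sum_n A(n) gam_n F_n, a constant. Hence the bound on Fejer means passes to
    the pairing as D tends to infinity. *)
Lemma hankel_extends F (c : R) : dirichlet_polynomial F -> weak_product_costs w Y F c ->
  normc (H2_inner w F g) <= K * c.
Proof.
move=> [N FN] [m [f [h [Yfh FE cE]]]].
rewrite (H2_inner_polynomial w g FN).
set I := \sum_(_ <= n < _) _.
pose E := \sum_(1 <= n < N.+1) normc ((grade n)%:R * gam n * F n).
have E0 : 0 <= E by apply: sumr_ge0 => n _; exact: normc_ge0.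
pose D0 := (N + \sum_(1 <= n < N.+1) grade n)%N.
have key D : (D0 <= D)%N -> D%:R * normc I <= D%:R * (K * c) + E.
  move=> D0D.
  have ND : (N.+1 <= 2 ^ D)%N.
    by apply: leq_ltn_trans (ltn_expl D (ltnSn 1)); apply: leq_trans D0D; rewrite leq_addr.
  have gD n : (0 < n <= N)%N -> (grade n <= D)%N.
    move=> /andP[n0 nN]; apply: leq_trans D0D; apply: leq_trans (leq_addl _ _).
    by rewrite (bigD1_seq n) ?iota_uniq ?mem_index_iota ?n0 //= leq_addr.
  have split : D%:R * I = \sum_(1 <= n < 2 ^ D) (D - grade n)%N%:R * gam n * F n
      + \sum_(1 <= n < N.+1) (grade n)%:R * gam n * F n.
    rewrite (@big_cat_nat _ _ _ N.+1 1 (2 ^ D)) //= [X in _ + X + _]big1_seq ?addr0; last first.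
      by move=> n; rewrite mem_index_iota => /andP[_ /andP[Nn _]]; rewrite FN // mulr0.
    rewrite -big_split mulr_sumr; apply: eq_big_nat => n hn /=.
    by rewrite natrB ?gD // /gam; ring.
  have -> : D%:R * normc I = normc (D%:R * I).
    by rewrite ComplexField.Normc.normcM; congr (_ * _); rewrite (normcMn (1 : C) D) ComplexField.Normc.normc1.
  rewrite split; apply: le_trans (le_normcD _ _) _; apply: lerD; last exact: normc_sum_le.
  rewrite (eq_big_nat _ _ (F2 := fun n => \sum_(i < m) (D - grade n)%N%:R * gam n * dmul (f i) (h i) n)); last first.
    by move=> n /andP[n0 _]; rewrite FE // mulr_sumr.
  rewrite exchange_big /=; apply: le_trans (normc_sum_le _ _ _) _.
  rewrite cE !mulr_sumr; apply: ler_sum => i _.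
  by have [Yf Yh] := Yfh i; exact: fejer_mean.
rewrite leNgt; apply/negP => lt; have d0 : 0 < normc I - K * c by rewrite subr_gt0.
(* Otherwise D times the excess would stay below the constant E. *)
pose D := maxn D0 (Num.bound (E / (normc I - K * c))).+1.
have := key D (leq_maxl _ _).
have : E / (normc I - K * c) < D%:R.
  apply: le_lt_trans (ler_norm _) _.
  apply: lt_le_trans (archi_boundP _) _; rewrite ?normr_ge0 //.
  by rewrite ger0_norm ?divr_ge0 ?(ltW d0) // ler_nat (leq_trans _ (leq_maxr _ _)).
rewrite ltr_pdivrMr //; lra.
Qed.

End Averaging.

Section Inclusion.
Variable R : realType.

Lemma dual_of_bound (w : nat -> R) Y (phi : dseries R) (K : R) : 0 <= K -> class_D phi ->
  (forall F c, dirichlet_polynomial F -> weak_product_costs w Y F c ->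
     ComplexField.Normc.normc (H2_inner w F phi) <= K * c) ->
  weak_product_dual w Y phi.
Proof.
move=> K0 D h.
(* K + 1 is positive, so that the infimum can be compared after division. *)
split=> //; exists (K + 1) => F pF ne.
have K1 : 0 < K + 1 by rewrite ltr_wpDl.
rewrite /weak_product_norm -ler_pdivrMl //; apply: lb_le_inf => // c hc.
rewrite ler_pdivrMl //; apply: le_trans (h F c pF hc) _.
rewrite ler_wpM2r ?lerDl //.
case: hc => m [f [g [_ _ ->]]]; apply: sumr_ge0 => i _.
by rewrite mulr_ge0 ?H2_norm_ge0.
Qed.

Lemma volterra_symbols_dual (w : nat -> R) Y : good_weight w -> admissible w Y ->
  volterra_symbols w Y `<=` weak_product_dual w Y.
Proof.
move=> gw adY g [Dg [M hM]].
have M0 : 0 <= `|M| by [].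
have hT f : Y f -> Y (volterra g f) /\ H2_norm w (volterra g f) <= `|M| * H2_norm w f.
  move=> /hM[h1 h2]; split=> //; apply: le_trans h2 _.
  by rewrite ler_wpM2r ?H2_norm_ge0 // ler_norm.
have K0 : 0 <= 2 * `|M| + ComplexField.Normc.normc (g 1%N) by rewrite addr_ge0 ?mulr_ge0 ?normc_ge0.
apply: (dual_of_bound K0 Dg) => F c; apply: (hankel_extends gw adY K0).
by move=> X f h; exact: (hankel_polynomial gw adY M0 hT).
Qed.

End Inclusion.

(** * Dirichlet convolution *)

Section Convolution.
Variable A : comPzRingType.
Implicit Types (f g h : nat -> A).

Definition conv f h (n : nat) : A := \sum_(d <- divisors n) f d * h (n %/ d)%N.

Lemma convE f h B n : (0 < n < B)%N ->
  conv f h n = \sum_(1 <= j < B) \sum_(1 <= k < B | (j * k == n)%N) f j * h k.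
Proof. by move=> hn; rewrite /conv (sum_divisors (fun j k => f j * h k) hn). Qed.

Lemma eq_conv f f' h h' n : (0 < n)%N ->
  (forall m, (0 < m)%N -> f m = f' m) -> (forall m, (0 < m)%N -> h m = h' m) ->
  conv f h n = conv f' h' n.
Proof.
move=> n0 ef eh; rewrite /conv big_seq [RHS]big_seq; apply: eq_bigr => d.
rewrite -dvdn_divisors // => dn; have d0 := dvdn_gt0 n0 dn.
by rewrite ef // eh // divn_gt0 // dvdn_leq.
Qed.

Lemma convC f h n : (0 < n)%N -> conv f h n = conv h f n.
Proof.
move=> n0; have hn : (0 < n < n.+1)%N by rewrite n0 ltnS leqnn.
rewrite !(convE _ _ hn).
under eq_bigr => j _ do rewrite big_mkcond.
rewrite exchange_big_nat; apply: eq_bigr => k _; rewrite -big_mkcond.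
by apply: eq_big => j; rewrite mulnC // mulrC.
Qed.

Lemma convA f g h n : (0 < n)%N -> conv f (conv g h) n = conv (conv f g) h n.
Proof.
move=> n0; have hn : (0 < n < n.+1)%N by rewrite n0 ltnS leqnn.
set B := n.+1 in hn.
transitivity (\sum_(1 <= j < B) \sum_(1 <= k < B) \sum_(1 <= l < B | (j * k * l == n)%N) f j * g k * h l).
  rewrite (convE _ _ hn); apply: eq_big_nat => j /andP[j0 _].
  transitivity (\sum_(1 <= m < B) \sum_(1 <= k < B) \sum_(1 <= l < B)
     if (j * m == n)%N && (k * l == m)%N then f j * g k * h l else 0).
    rewrite big_mkcond; apply: eq_big_nat => m hm; case: eqP => _; last first.
      by rewrite big1 // => k _; rewrite big1.
    rewrite (convE _ _ hm) mulr_sumr; apply: eq_bigr => k _; rewrite mulr_sumr big_mkcond.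
    by apply: eq_bigr => l _; case: ifP => //= _; rewrite mulrA.
  rewrite exchange_big_nat; apply: eq_big_nat => k /andP[k0 _].
  rewrite exchange_big_nat [RHS]big_mkcond; apply: eq_big_nat => l /andP[l0 _].
  rewrite -big_mkcond (eq_bigl (fun m => (m == k * l) && (j * (k * l) == n)))%N; last first.
    by move=> m; rewrite andbC [(k * l == m)%N]eq_sym; case: (m =P k * l)%N => // ->.
  rewrite -mulnA; case: (boolP (j * (k * l) == n)%N) => [/eqP E|_]; last first.
    by rewrite big1 // => m; rewrite andbF.
  under eq_bigl do rewrite andbT.
  rewrite big_nat1_eq muln_gt0 k0 l0 /= ifT // /B ltnS -E leq_pmull //.
rewrite (convE _ _ hn).
transitivity (\sum_(1 <= m < B) \sum_(1 <= j < B) \sum_(1 <= k < B) \sum_(1 <= l < B)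
     if (m * l == n)%N && (j * k == m)%N then f j * g k * h l else 0).
  rewrite [RHS]exchange_big_nat; apply: eq_big_nat => j /andP[j0 _].
  rewrite [RHS]exchange_big_nat; apply: eq_big_nat => k /andP[k0 _].
  rewrite [RHS]exchange_big_nat [LHS]big_mkcond; apply: eq_big_nat => l /andP[l0 _].
  rewrite -[RHS]big_mkcond [RHS](eq_bigl (fun m => (m == j * k) && (j * k * l == n)))%N; last first.
    by move=> m; rewrite andbC [(j * k == m)%N]eq_sym; case: (m =P j * k)%N => // ->.
  case: (boolP (j * k * l == n)%N) => [/eqP E|_]; last first.
    by rewrite big1 // => m; rewrite andbF.
  under eq_bigl do rewrite andbT.
  by rewrite big_nat1_eq muln_gt0 j0 k0 /= ifT // /B ltnS -E leq_pmulr.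
apply: eq_big_nat => m hm.
rewrite (eq_bigr (fun j => \sum_(1 <= l < B) \sum_(1 <= k < B)
     if (m * l == n)%N && (j * k == m)%N then f j * g k * h l else 0)); last first.
  by move=> j _; rewrite exchange_big_nat.
rewrite exchange_big_nat [RHS]big_mkcond; apply: eq_big_nat => l _.
case: eqP => _ /=; last by rewrite big1 // => j _; rewrite big1.
rewrite (convE _ _ hm) mulr_suml; apply: eq_bigr => j _.
by rewrite mulr_suml [RHS]big_mkcond.
Qed.

Lemma convZr (a : A) f h n : conv f (fun m => a * h m) n = a * conv f h n.
Proof. by rewrite /conv mulr_sumr; apply: eq_bigr => d _; rewrite mulrCA. Qed.

Definition conv1 (n : nat) : A := (n == 1%N)%:R.

Lemma conv1l f n : (0 < n)%N -> conv conv1 f n = f n.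
Proof.
move=> n0; rewrite /conv (bigD1_seq 1%N) ?divisors_uniq ?divisor1 //=.
rewrite /conv1 eqxx mul1r divn1 big1 ?addr0 // => d /negbTE ->.
by rewrite mul0r.
Qed.

Fixpoint conv_exp f m : nat -> A := if m is m'.+1 then conv f (conv_exp f m') else conv1.

Lemma conv_expD f a b n : (0 < n)%N ->
  conv (conv_exp f a) (conv_exp f b) n = conv_exp f (a + b) n.
Proof.
elim: a n => [|a IH] n n0; first by rewrite conv1l.
by rewrite addSn /= -convA //; apply: eq_conv => // m m0; exact: IH.
Qed.

End Convolution.

Section Leibniz.
Variable R : realType.
Implicit Types (f h : nat -> R).

Definition dln f (n : nat) : R := f n * ln n%:R.

Lemma dln_conv f h n : (0 < n)%N ->
  dln (conv f h) n = conv (dln f) h n + conv f (dln h) n.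
Proof.
move=> n0; rewrite /dln /conv mulr_suml -big_split big_seq [RHS]big_seq /=.
apply: eq_bigr => d; rewrite -dvdn_divisors // => dn; have d0 := dvdn_gt0 n0 dn.
have q0 : (0 < n %/ d)%N by rewrite divn_gt0 // dvdn_leq.
rewrite -[X in ln X%:R](divnK dn) natrM lnM ?posrE ?ltr0n //; ring.
Qed.

Lemma dln_conv_exp f m n : (0 < n)%N ->
  dln (conv_exp f m.+1) n = m.+1%:R * conv (conv_exp f m) (dln f) n.
Proof.
elim: m n => [|m IH] n n0.
  rewrite /= conv1l // mul1r /dln convC // conv1l //.
have -> : dln (conv_exp f m.+2) n = dln (conv f (conv_exp f m.+1)) n by [].
rewrite dln_conv // [conv (dln f) _ n]convC //.
rewrite (@eq_conv _ f f (dln (conv_exp f m.+1))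
   (fun k => m.+1%:R * conv (conv_exp f m) (dln f) k)) //.
by rewrite convZr convA // -[m.+2%:R]natr1 mulrDl mul1r addrC.
Qed.

(** The identity (a + m) f^a (f^m)' = m (f^(a + m))' for the derivation
    f' = dln f, with m.+1 for m. *)
Lemma conv_dln_conv_exp f a m n : (0 < n)%N ->
  (a + m.+1)%:R * conv (conv_exp f a) (dln (conv_exp f m.+1)) n =
  m.+1%:R * dln (conv_exp f (a + m.+1)) n.
Proof.
move=> n0; rewrite addnS dln_conv_exp //.
rewrite (@eq_conv _ _ (conv_exp f a) (dln (conv_exp f m.+1))
   (fun k => m.+1%:R * conv (conv_exp f m) (dln f) k)) //; last first.
  by move=> k k0; rewrite dln_conv_exp.
rewrite convZr convA // mulrCA; congr (_ * (_ * _)).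
by apply: eq_conv => // k k0; exact: conv_expD.
Qed.

End Leibniz.

(** * Homogeneous symbols *)

Section Homogeneous.
Variable R : realType.
Local Notation C := R[i].
Implicit Types (f h : dseries R).

(** The number of prime factors, counted with multiplicity. *)
Definition bigomega := add_fun (fun=> 1%N).

Lemma bigomegaM m n : (0 < m)%N -> (0 < n)%N ->
  bigomega (m * n) = (bigomega m + bigomega n)%N.
Proof. exact: add_funM. Qed.

Lemma bigomega_prime p : prime p -> bigomega p = 1%N.
Proof. by move=> pp; rewrite /bigomega add_fun_prime. Qed.

Lemma size_divisors_le n : (0 < n)%N -> (size (divisors n) <= 2 ^ bigomega n)%N.
Proof.
move: n; apply: (@prime_ind (fun n => size (divisors n) <= 2 ^ bigomega n)%N) => [|p n pp n0 IH].
  by rewrite expn_gt0.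
rewrite bigomegaM ?(prime_gt0 pp) // (bigomega_prime pp) expnD expn1 mul2n -addnn.
apply: leq_trans (leq_add IH IH).
rewrite -[X in (_ <= _ + X)%N](size_map (muln p)) -size_cat.
apply: uniq_leq_size; first exact: divisors_uniq.
have pn0 : (0 < p * n)%N by rewrite muln_gt0 (prime_gt0 pp).
move=> d; rewrite -dvdn_divisors // mem_cat -dvdn_divisors // => dpn.
case: (boolP (p %| d)%N) => [/dvdnP[e E]|pd].
  apply/orP; right; rewrite E mulnC; apply: map_f; rewrite -dvdn_divisors //.
  by move: dpn; rewrite E mulnC dvdn_pmul2l // prime_gt0.
have cop : coprime d p by rewrite coprime_sym prime_coprime.
by move: dpn; rewrite Gauss_dvdr // => ->.
Qed.

(** Cauchy-Schwarz over the divisors of n, of which there are at most 2^m. *)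
Lemma homogeneous_dmul_le m N f h :
  \sum_(1 <= n < N | bigomega n == m) sqmod (dmul f h n) <=
  2 ^+ m * ((\sum_(1 <= j < N) sqmod (f j)) * (\sum_(1 <= k < N) sqmod (h k))).
Proof.
apply: (@le_trans _ _ (\sum_(1 <= n < N) \sum_(1 <= j < N) \sum_(1 <= k < N)
   if (j * k == n)%N then 2 ^+ m * (sqmod (f j) * sqmod (h k)) else 0)).
  rewrite big_mkcond; apply: ler_sum_nat => n hn; have /andP[n0 _] := hn.
  have E : \sum_(1 <= j < N) \sum_(1 <= k < N)
      (if (j * k == n)%N then 2 ^+ m * (sqmod (f j) * sqmod (h k)) else 0) =
      2 ^+ m * \sum_(d <- divisors n) sqmod (f d) * sqmod (h (n %/ d)%N).
    rewrite (sum_divisors (fun j k => sqmod (f j) * sqmod (h k)) hn) mulr_sumr.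
    by apply: eq_bigr => j _; rewrite mulr_sumr [RHS]big_mkcond.
  rewrite E; have S0 : 0 <= \sum_(d <- divisors n) sqmod (f d) * sqmod (h (n %/ d)%N).
    by apply: sumr_ge0 => d _; rewrite mulr_ge0 ?sqmod_ge0.
  case: eqP => [om|_]; last by rewrite mulr_ge0 ?exprn_ge0.
  rewrite /dmul (eq_bigr (fun d => 1 * (f d * h (n %/ d)%N))); last by move=> d _; rewrite mul1r.
  apply: le_trans (sqmod_cauchy_schwarz _ _ _ _) _.
  rewrite [X in _ * X](eq_bigr (fun d => sqmod (f d) * sqmod (h (n %/ d)%N))); last first.
    by move=> d _; rewrite sqmodM.
  rewrite ler_wpM2r // (eq_bigr (fun=> 1)); last by move=> d _; rewrite (sqmod_real 1) expr1n.
  rewrite big_const_seq count_predT iter_addr_0 -natrX ler_nat.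
  by apply: leq_trans (size_divisors_le n0) _; rewrite om.
rewrite exchange_big_nat mulr_suml mulr_sumr; apply: ler_sum => j _.
rewrite exchange_big_nat !mulr_sumr; apply: ler_sum => k _.
rewrite -big_mkcond (eq_bigl (fun n => n == j * k)%N); last by move=> n; rewrite eq_sym.
rewrite big_nat1_eq; case: ifP => // _.
apply: mulr_ge0; first exact: exprn_ge0.
by apply: mulr_ge0; exact: sqmod_ge0.
Qed.

Lemma good_weight_le_exp w : good_weight w ->
  exists2 B : R, 1 <= B & forall n, (0 < n)%N -> w n <= B ^+ bigomega n.
Proof.
move=> gw; have [w1 [B wB] _] := gw; exists (Num.max 1 B); first by rewrite le_max lexx.
apply: prime_ind => [|p n pp n0 IH]; first by rewrite w1 /bigomega add_fun1 expr0.
rewrite bigomegaM ?(prime_gt0 pp) // (bigomega_prime pp) exprS.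
have /andP[_ h] := wB p n pp n0; apply: le_trans h _.
apply: (@le_trans _ _ (Num.max 1 B * w n)).
  by rewrite ler_wpM2r ?le_max ?lexx ?orbT // ltW // good_weight_gt0.
by apply: ler_wpM2l => //; rewrite le_max ler01.
Qed.

(** Only the coefficients of f and h at integers with at most m prime factors enter
    the form, and there the weights lie between 1 and c^m, so that the
    unweighted estimate [homogeneous_dmul_le] applies. *)
Lemma homogeneous_dual w m (phi : dseries R) (B : R) Y : good_weight w ->
  (forall f, Y f -> H2 w f) -> class_D phi ->
  (forall n, (0 < n)%N -> bigomega n != m -> phi n = 0) ->
  (forall N, \sum_(1 <= n < N) sqmod (phi n) <= B) ->
  weak_product_dual w Y phi.
Proof.
move=> gw sub Dphi hom hB.
have B0 : 0 <= B by have := hB 0%N; rewrite big_geq.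
have [c c1 wc] := good_weight_le_exp gw.
have c0 : 0 <= c by apply: le_trans c1.
pose K := Num.sqrt (2 ^+ m * B) * c ^+ m.
have K0 : 0 <= K by rewrite mulr_ge0 ?sqrtr_ge0 ?exprn_ge0.
apply: (dual_of_bound K0) => // F x [N FN] [q [f [h [Yfh FE xE]]]].
rewrite (H2_inner_polynomial w phi FN).
rewrite (eq_big_nat _ _ (F2 := fun n => \sum_(i < q) dmul (f i) (h i) n * (Num.conj (phi n) / (w n)%:C))); last first.
  by move=> n /andP[n0 _]; rewrite FE // -mulrA mulr_suml.
rewrite exchange_big /=; apply: le_trans (normc_sum_le _ _ _) _.
rewrite xE mulr_sumr; apply: ler_sum => i _.
have [/sub Hf /sub Hh] := Yfh i; move: (f i) (h i) Hf Hh => u v Hu Hv.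
pose u' := restrict (fun n => bigomega n <= m)%N u.
pose v' := restrict (fun n => bigomega n <= m)%N v.
have bound a : H2 w a -> \sum_(1 <= j < N.+1) sqmod (restrict (fun n => bigomega n <= m)%N a j) <= c ^+ m * H2_norm w a ^+ 2.
  move=> Ha; apply: le_trans (ler_wpM2l (exprn_ge0 m c0) (H2_partial_le gw N.+1 Ha)).
  rewrite mulr_sumr; apply: ler_sum_nat => j /andP[j0 _].
  have wj := good_weight_gt0 gw j0.
  rewrite /restrict; case: ifP => om; last by rewrite sqmod0 mulr_ge0 ?exprn_ge0 ?divr_ge0 ?sqmod_ge0 // ltW.
  rewrite mulrCA ler_peMr ?sqmod_ge0 // ler_pdivlMr // mul1r.
  by apply: le_trans (wc j j0) _; rewrite ler_weXn2l.
rewrite -(@ler_pXn2r _ 2) ?nnegrE ?normc_ge0 //; last first.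
  by apply: mulr_ge0 => //; apply: mulr_ge0; exact: H2_norm_ge0.
rewrite -/(sqmod _).
rewrite (_ : \sum_(1 <= n < N.+1) _ = \sum_(1 <= n < N.+1 | bigomega n == m)
    dmul u' v' n * (Num.conj (phi n) / (w n)%:C)); last first.
  rewrite [RHS]big_mkcond; apply: eq_big_nat => n /andP[n0 _].
  case: eqP => [om|/eqP om]; last by rewrite hom // rmorph0 mul0r mulr0.
  congr (_ * _); rewrite /dmul big_seq [RHS]big_seq; apply: eq_bigr => d.
  rewrite -dvdn_divisors // => dn; have d0 := dvdn_gt0 n0 dn.
  have q0 : (0 < n %/ d)%N by rewrite divn_gt0 // dvdn_leq.
  have := om; rewrite -{1}(divnK dn) bigomegaM // => om'.
  by rewrite /u' /v' /restrict -om' leq_addl leq_addr.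
apply: le_trans (sqmod_cauchy_schwarz _ _ _ _) _.
have P1 : \sum_(1 <= n < N.+1 | bigomega n == m) sqmod (dmul u' v' n) <=
   2 ^+ m * (c ^+ m * H2_norm w u ^+ 2 * (c ^+ m * H2_norm w v ^+ 2)).
  apply: le_trans (homogeneous_dmul_le _ _ _ _) _.
  rewrite ler_wpM2l ?exprn_ge0 // ler_pM ?bound //; apply: sumr_ge0 => *; exact: sqmod_ge0.
have P2 : \sum_(1 <= n < N.+1 | bigomega n == m) sqmod ((Num.conj (phi n) : C) / (w n)%:C) <= B.
  apply: le_trans (hB N.+1); rewrite big_mkcond; apply: ler_sum_nat => n /andP[n0 _].
  case: ifP => _; last exact: sqmod_ge0.
  rewrite sqmodM sqmod_conj ler_piMr ?sqmod_ge0 // -fmorphV sqmod_real.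
  have := good_weight_ge1 gw n0 => w1.
  by rewrite exprn_ile1 ?invr_ge0 ?invf_le1 ?(le_trans ler01) ?good_weight_gt0.
apply: le_trans (ler_pM _ _ P1 P2) _.
- by apply: sumr_ge0 => *; exact: sqmod_ge0.
- by apply: sumr_ge0 => *; exact: sqmod_ge0.
have mB : 0 <= 2 ^+ m * B by apply: mulr_ge0 => //; exact: exprn_ge0.
rewrite /K !exprMn (sqr_sqrtr mB).
rewrite le_eqVlt; apply/orP; left; apply/eqP; ring.
Qed.

End Homogeneous.

(** * Absolute convergence *)

Section AbsoluteConvergence.
Variable R : realType.
Local Notation C := R[i].
Local Notation normc := ComplexField.Normc.normc.

Lemma cvg_complex (u : nat -> C) (a b : R) :
  (fun n => complex.Re (u n)) @ \oo --> a -> (fun n => complex.Im (u n)) @ \oo --> b ->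
  (u : nat -> C^o) @ \oo --> ((a +i* b) : C^o).
Proof.
move=> ha hb; apply/cvgrPdist_lt => e e0.
have [e1 e10 E] : exists2 e1 : R, 0 < e1 & e = e1%:C.
  move: e0; case: e => x y; rewrite ltcE /= => /andP[/eqP -> x0].
  by exists x.
have e2 : 0 < e1 / 2 by rewrite divr_gt0.
move/cvgrPdist_lt : ha => /(_ _ e2) ha; move/cvgrPdist_lt : hb => /(_ _ e2) hb.
near=> n.
have ra : `|a - complex.Re (u n)| < e1 / 2 by near: n.
have rb : `|b - complex.Im (u n)| < e1 / 2 by near: n.
rewrite E; change (`|(a +i* b) - u n| < e1%:C :> C); rewrite -[`|_|]/((normc ((a +i* b) - u n))%:C) ltcR.
have -> : (a +i* b) - u n = (a - complex.Re (u n))%:C + 'i%C * (b - complex.Im (u n))%:C.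
  case: (u n) => x y; apply/eqP; rewrite eq_complex /=; apply/andP; split; apply/eqP; ring.
apply: le_lt_trans (le_normcD _ _) _; rewrite ComplexField.Normc.normcM /=.
rewrite !expr0n /= !expr1n !addr0 add0r !sqrtr_sqr sqrtr1 mul1r; lra.
Unshelve. all: end_near.
Qed.

Lemma cvg_dominated (x : nat -> R) :
  (forall n, (0 < n)%N -> `|x n| <= n%:R `^ (- 2)) ->
  cvgn (fun N => \sum_(1 <= n < N) x n).
Proof.
move=> hx; pose y n := if (0 < n)%N then x n else 0.
have E : (fun N => \sum_(1 <= n < N) x n) = series y.
  apply/funext => N; rewrite /series /=; case: N => [|N]; first by rewrite !big_geq.
  rewrite [RHS]big_ltn // /y add0r; apply: eq_big_nat => n /andP[n0 _].
  by rewrite n0.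
rewrite E; apply: normed_cvg.
apply: nondecreasing_is_cvgn.
  by apply/nondecreasing_seqP => n; rewrite /normed_series_of !seriesEnat /= big_nat_recr //= lerDl.
exists 2 => _ [N _ <-]; rewrite /normed_series_of seriesEnat /=.
case: N => [|N]; first by rewrite big_geq.
rewrite big_ltn // {1}/y normr0 add0r.
apply: le_trans (sum_inv_sq_le R N.+1); apply: ler_sum_nat => n /andP[n0 _].
by rewrite /y n0 hx.
Qed.

Lemma class_D_polynomial_growth (x : nat -> R) (m : nat) :
  (forall n, (0 < n)%N -> `|x n| <= n%:R ^+ m) -> class_D (fun n => (x n)%:C : C).
Proof.
move=> hx; exists (m%:R + 2) => s hs.
pose t n := x n * n%:R `^ (- complex.Re s).
have ht n (c : R) : (0 < n)%N -> `|c| <= 1 -> `|t n * c| <= n%:R `^ (- 2).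
  move=> n0 c1; rewrite /t !normrM [`|_ `^ _|]ger0_norm ?powR_ge0 //.
  apply: (@le_trans _ _ (n%:R ^+ m * n%:R `^ (- complex.Re s) * 1)).
    by rewrite ler_pM ?mulr_ge0 ?powR_ge0 // ler_wpM2r ?powR_ge0 ?hx.
  rewrite mulr1 -powR_mulrn // -powRD ?pnatr_eq0 -?lt0n ?n0 ?implybT //.
  by apply: le_powRN_exp => //; move: hs; lra.
have sinN n : `|- sin (complex.Im s * ln n%:R)| <= 1 by rewrite normrN sin_max.
have c1 := @cvg_dominated (fun n => t n * cos (complex.Im s * ln n%:R))
  (fun n n0 => ht n _ n0 (cos_max _)).
have c2 := @cvg_dominated (fun n => t n * - sin (complex.Im s * ln n%:R))
  (fun n n0 => ht n _ n0 (sinN n)).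
move: c1 c2 => /cvg_ex[l1 c1] /cvg_ex[l2 c2].
pose S N : C := \sum_(1 <= n < N) (x n)%:C * nat_cpow_opp n s.
have ImD (z z' : C) : complex.Im (z + z') = complex.Im z + complex.Im z'.
  by case: z; case: z'.
have ReS : (fun N => complex.Re (S N)) =
    (fun N => \sum_(1 <= n < N) t n * cos (complex.Im s * ln n%:R)).
  apply/funext => N; rewrite Re_sum; apply: eq_bigr => n _.
  by rewrite /nat_cpow_opp /t /=; ring.
have ImS : (fun N => complex.Im (S N)) =
    (fun N => \sum_(1 <= n < N) t n * - sin (complex.Im s * ln n%:R)).
  apply/funext => N.
  rewrite (big_morph _ ImD (erefl : complex.Im (0 : C) = 0)); apply: eq_bigr => n _.
  by rewrite /nat_cpow_opp /t /=; ring.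
apply/cvg_ex; exists (l1 +i* l2); apply: (@cvg_complex S); [rewrite ReS | rewrite ImS].
  exact: c1.
exact: c2.
Qed.

End AbsoluteConvergence.

(** * Powers of a prime-supported series *)

Section PrimeIndex.

Definition prime_index (n : nat) : nat := (\sum_(0 <= q < n) prime q)%N.

Lemma prime_indexS n : prime_index n.+1 = (prime_index n + prime n)%N.
Proof. by rewrite /prime_index big_nat_recr. Qed.

Lemma prime_index_onto k : exists N, prime_index N = k.
Proof.
elim: k => [|k [N IH]]; first by exists 0%N; rewrite /prime_index big_geq.
have ex : exists p, (N <= p)%N && prime p.
  by have [p Np pp] := prime_above N; exists p; rewrite ltnW.
pose p := ex_minn ex; have : [/\ (N <= p)%N, prime p & forall q, (N <= q < p)%N -> ~~ prime q].
  rewrite /p; case: ex_minnP => q /andP[Nq pq] min; split=> // r /andP[Nr rq].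
  by apply/negP => pr; have := min r; rewrite Nr pr leqNgt rq => /(_ isT).
move=> [Np pp min]; exists p.+1; rewrite prime_indexS pp addn1 -IH; congr _.+1.
rewrite /prime_index (@big_cat_nat _ _ _ N 0 p) //= [X in (_ + X)%N]big1_seq ?addn0 //.
by move=> q; rewrite mem_index_iota => /= /min /negbTE ->.
Qed.

Lemma sum_prime_index (V : nmodType) (F : nat -> V) N :
  \sum_(0 <= p < N | prime p) F (prime_index p) = \sum_(0 <= i < prime_index N) F i.
Proof.
elim: N => [|N IH]; first by rewrite /prime_index !big_geq.
rewrite big_mkcond big_nat_recr //= -big_mkcond IH prime_indexS.
by case: (prime N); rewrite ?addn1 ?addn0 ?addr0 // big_nat_recr.
Qed.

Lemma prod_prime_index (A : comPzRingType) (F : nat -> A) N :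
  \prod_(0 <= p < N | prime p) F (prime_index p) = \prod_(0 <= i < prime_index N) F i.
Proof.
elim: N => [|N IH]; first by rewrite /prime_index !big_geq.
rewrite prime_prod_recr IH prime_indexS.
by case: (prime N); rewrite ?addn1 ?addn0 ?mulr1 // big_nat_recr.
Qed.

End PrimeIndex.

Section Symbol.
Variable R : realType.
Local Notation C := R[i].

(** (i + 1)^(-1/4), so that only integral powers occur below. *)
Definition root4 (i : nat) : R := (Num.sqrt (Num.sqrt i.+1%:R))^-1.

Lemma root4_gt0 i : 0 < root4 i.
Proof. by rewrite invr_gt0 !sqrtr_gt0. Qed.

Lemma root4_le1 i : root4 i <= 1.
Proof.
rewrite invf_le1 ?sqrtr_gt0 ?sqrtr_gt0 //.
by rewrite -[X in X <= _]sqrtr1 ler_sqrt // -[X in X <= _]sqrtr1 ler_sqrt // ler1n.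
Qed.

Lemma root4_exp4 i : root4 i ^+ 4 = i.+1%:R^-1.
Proof.
rewrite /root4 exprVn (_ : 4%N = (2 * 2)%N) // exprM sqr_sqrtr ?sqrtr_ge0 //.
by rewrite sqr_sqrtr.
Qed.

(** The exponent 3/4 lies above 1/2, which makes the series square summable,
    and far enough below 1 for the powers of the series to grow. *)
Definition prime_symbol (n : nat) : R := if prime n then root4 (prime_index n) ^+ 3 else 0.
Local Notation ell := prime_symbol.

Lemma prime_symbol_ge0 n : 0 <= ell n.
Proof. by rewrite /prime_symbol; case: ifP => // _; rewrite exprn_ge0 // ltW ?root4_gt0. Qed.

Lemma prime_symbol_le1 n : ell n <= 1.
Proof.
rewrite /prime_symbol; case: ifP => // _.
by rewrite exprn_ile1 ?root4_le1 // ltW ?root4_gt0.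
Qed.

(** Telescoping of (i + 1)^(-3/2) against 2 / sqrt i - 2 / sqrt (i + 1). *)
Lemma sum_root4_exp6_le K : \sum_(0 <= i < K) root4 i ^+ 6 <= 3.
Proof.
have r6 i : root4 i ^+ 6 = (Num.sqrt i.+1%:R ^+ 3)^-1.
  by rewrite /root4 exprVn (_ : 6%N = (2 * 3)%N) // exprM sqr_sqrtr ?sqrtr_ge0.
have H K' : \sum_(0 <= i < K'.+1) root4 i ^+ 6 <= 3 - 2 / Num.sqrt K'.+1%:R.
  elim: K' => [|K' IH]; first by rewrite big_nat1 r6 sqrtr1 expr1n; lra.
  rewrite big_nat_recr //=; apply: le_trans (lerD IH (lexx _)) _; rewrite r6.
  have x2 : Num.sqrt (K'.+1%:R : R) ^+ 2 = K'.+1%:R by rewrite sqr_sqrtr.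
  have y2 : Num.sqrt (K'.+2%:R : R) ^+ 2 = K'.+1%:R + 1 by rewrite sqr_sqrtr // natr1.
  have x0 : 0 < Num.sqrt (K'.+1%:R : R) by rewrite sqrtr_gt0.
  have y0 : 0 < Num.sqrt (K'.+2%:R : R) by rewrite sqrtr_gt0.
  have xy : Num.sqrt (K'.+1%:R : R) <= Num.sqrt (K'.+2%:R : R).
    by rewrite ler_sqrt // ler_nat.
  move: (Num.sqrt (K'.+1%:R : R)) (Num.sqrt (K'.+2%:R : R)) x2 y2 x0 y0 xy => x y x2 y2 x0 y0 xy.
  rewrite -subr_ge0.
  have -> : 3 - 2 / y - (3 - 2 / x + (y ^+ 3)^-1) =
     (2 * y ^+ 2 * (y - x) - x) / (x * y ^+ 3).
    by field; rewrite !gt_eqF.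
  rewrite divr_ge0 ?mulr_ge0 ?exprn_ge0 ?(ltW x0) ?(ltW y0) //.
  have yx1 : (y - x) * (y + x) = 1.
    have -> : (y - x) * (y + x) = y ^+ 2 - x ^+ 2 by ring.
    by rewrite y2 x2; ring.
  have : 0 <= y - x by rewrite subr_ge0.
  move: yx1; nra.
case: K => [|K]; first by rewrite big_geq.
apply: le_trans (H K) _; rewrite lerBlDr lerDl divr_ge0 ?sqrtr_ge0 //.
Qed.

Lemma prime_symbol_square_sum N : \sum_(1 <= n < N) ell n ^+ 2 <= 3.
Proof.
apply: le_trans (sum_root4_exp6_le (prime_index N)).
rewrite -(sum_prime_index (fun i => root4 i ^+ 6)).
rewrite (_ : \sum_(1 <= n < N) ell n ^+ 2 = \sum_(0 <= n < N) ell n ^+ 2).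
  rewrite [leRHS]big_mkcond; apply: ler_sum => n _; rewrite /prime_symbol; case: ifP => _.
    by rewrite -exprM.
  by rewrite expr0n.
case: N => [|N]; first by rewrite !big_geq.
by rewrite [RHS]big_ltn // expr0n add0r.
Qed.

Lemma conv_exp_ge0 m n : 0 <= conv_exp ell m n.
Proof.
elim: m n => [|m IH] n /=; first exact: ler0n.
by apply: sumr_ge0 => d _; rewrite mulr_ge0 ?prime_symbol_ge0.
Qed.

Lemma conv_exp_homogeneous m n : (0 < n)%N -> bigomega n != m -> conv_exp ell m n = 0.
Proof.
elim: m n => [|m IH] n n0 om /=.
  rewrite /conv1; case: eqP => // n1; move: om.
  by rewrite n1 /bigomega add_fun1.
rewrite /conv big_seq big1 // => d; rewrite -dvdn_divisors // => dn.
have q0 : (0 < n %/ d)%N by rewrite divn_gt0 ?(dvdn_gt0 n0 dn) // dvdn_leq.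
rewrite /prime_symbol; case: ifP => pd; last by rewrite mul0r.
rewrite IH ?mulr0 //; apply: contraNneq om => <-.
by rewrite -{1}(divnK dn) bigomegaM ?(prime_gt0 pd) // (bigomega_prime pd) addn1.
Qed.

Lemma conv_exp_growth m n : (0 < n)%N -> conv_exp ell m n <= n%:R ^+ m.
Proof.
elim: m n => [|m IH] n n0 /=.
  by rewrite /conv1 expr0; case: eqP.
apply: (@le_trans _ _ (\sum_(d <- divisors n) n%:R ^+ m)).
  rewrite /conv big_seq [leRHS]big_seq; apply: ler_sum => d; rewrite -dvdn_divisors // => dn.
  have q0 : (0 < n %/ d)%N by rewrite divn_gt0 ?(dvdn_gt0 n0 dn) // dvdn_leq.
  apply: (@le_trans _ _ (1 * (n %/ d)%:R ^+ m)).
    by rewrite ler_pM ?prime_symbol_ge0 ?prime_symbol_le1 ?conv_exp_ge0 ?IH.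
  by rewrite mul1r lerXn2r ?nnegrE // ler_nat leq_div.
rewrite big_const_seq count_predT iter_addr_0 -[leLHS]mulr_natl exprS.
rewrite ler_wpM2r ?exprn_ge0 // ler_nat.
rewrite -[X in (_ <= X)%N](size_iota 1); apply: uniq_leq_size; first exact: divisors_uniq.
move=> d; rewrite -dvdn_divisors // mem_iota add1n ltnS => dn.
by rewrite (dvdn_gt0 n0 dn) dvdn_leq.
Qed.

Lemma conv_exp_square_summable m : exists B, forall N,
  \sum_(1 <= n < N) sqmod ((conv_exp ell m n)%:C : C) <= B.
Proof.
elim: m => [|m [B IH]].
  exists 1 => N; rewrite (eq_bigr (fun n => if n == 1%N then 1 else 0)); last first.
    by move=> n _; rewrite sqmod_real /= /conv1; case: eqP; rewrite ?expr1n ?expr0n.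
  by rewrite -big_mkcond big_nat1_eq; case: ifP.
exists (2 ^+ m.+1 * (3 * B)) => N.
rewrite (_ : \sum_(1 <= n < N) _ = \sum_(1 <= n < N | bigomega n == m.+1)
   sqmod (dmul (fun k => (ell k)%:C : C) (fun k => (conv_exp ell m k)%:C) n)); last first.
  rewrite [RHS]big_mkcond; apply: eq_big_nat => n /andP[n0 _].
  case: eqP => [_|/eqP om]; last by rewrite conv_exp_homogeneous // sqmod0.
  congr sqmod; rewrite /dmul /= /conv rmorph_sum; apply: eq_bigr => d _.
  exact: real_complexM.
apply: le_trans (homogeneous_dmul_le _ _ _ _) _.
apply: ler_wpM2l; first exact: exprn_ge0.
apply: ler_pM => //; do ?by apply: sumr_ge0 => *; exact: sqmod_ge0.
apply: le_trans (prime_symbol_square_sum N); apply: ler_sum => n _.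
by rewrite sqmod_real.
Qed.

(** The primes of s can be distributed to the factors in (size s)! ways. *)
Lemma conv_exp_squarefree (s : seq nat) : uniq s -> all prime s ->
  (size s)`!%:R * \prod_(p <- s) ell p <= conv_exp ell (size s) (\prod_(p <- s) p)%N.
Proof.
move sE : (size s) => K; elim: K s sE => [|K IH] s sE us ps.
  by rewrite (size0nil sE) !big_nil /= /conv1 fact0 mulr1.
set n := (\prod_(p <- s) p)%N.
have n0 : (0 < n)%N.
  by rewrite /n big_seq prodn_cond_gt0 // => p /(allP ps) /prime_gt0.
apply: (@le_trans _ _ (\sum_(p <- s) ell p * conv_exp ell K (n %/ p)%N)).
  rewrite (_ : _ * _ = \sum_(p <- s) K`!%:R * \prod_(q <- s) ell q); last first.
    by rewrite big_const_seq count_predT iter_addr_0 sE factS natrM -mulrA -[RHS]mulr_natl.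
  rewrite big_seq [leRHS]big_seq; apply: ler_sum => p hp.
  have pp := allP ps p hp.
  rewrite [X in _ * X](big_rem p) //= mulrCA ler_wpM2l ?prime_symbol_ge0 //.
  have -> : (n %/ p = \prod_(q <- rem p s) q)%N.
    by rewrite /n (big_rem p) //= mulKn // prime_gt0.
  apply: IH; [by rewrite size_rem // sE|exact: rem_uniq|].
  by apply/allP => q /mem_rem; apply: (allP ps).
rewrite /= /conv.
apply: (@ler_sum_inj _ _ _ _ _ id (fun d => ell d * conv_exp ell K (n %/ d)%N)) => //.
- exact: divisors_uniq.
- by move=> p hp /=; rewrite -dvdn_divisors // /n (big_rem p) //= dvdn_mulr.
- by move=> d _; rewrite mulr_ge0 ?prime_symbol_ge0 ?conv_exp_ge0.
Qed.

(** For the first K primes the coefficient is K! tau^3, where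
    tau = K!^(-1/4) is the product of the [root4] values, thus 1 / tau. *)
Lemma conv_exp_large K : exists n, [/\ (0 < n)%N, bigomega n = K &
  K`!%:R <= conv_exp ell K n ^+ 4].
Proof.
have [N NK] := prime_index_onto K.
pose s := [seq p <- index_iota 0 N | prime p].
have ps : all prime s by apply/allP => p; rewrite mem_filter => /andP[].
have us : uniq s by rewrite filter_uniq ?iota_uniq.
have sK : size s = K.
  by rewrite -NK /s size_filter -sum1_count /prime_index big_mkcond; apply: eq_bigr => q _; case: prime.
have pos : all (ltn 0) s by apply/allP => p /(allP ps) /prime_gt0.
have om : forall t : seq nat, all prime t -> (0 < \prod_(p <- t) p)%N /\ bigomega (\prod_(p <- t) p) = size t.
  elim=> [|p t IH] /=; first by rewrite big_nil /bigomega add_fun1.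
  move=> /andP[pp /IH[t0 tE]]; rewrite big_cons muln_gt0 (prime_gt0 pp) t0.
  by rewrite bigomegaM ?(prime_gt0 pp) // (bigomega_prime pp) tE.
have [n0 oE] := om s ps.
exists (\prod_(p <- s) p)%N; split=> //; first by rewrite oE.
have := conv_exp_squarefree us ps; rewrite sK => h.
pose tau : R := \prod_(0 <= i < K) root4 i.
have tau0 : 0 < tau by apply: prodr_gt0 => i _; exact: root4_gt0.
have tau4 : tau ^+ 4 = K`!%:R^-1.
  rewrite /tau -prodrXl (eq_bigr (fun i => i.+1%:R^-1)); last by move=> i _; exact: root4_exp4.
  elim: (K) => [|k IH]; first by rewrite big_geq // fact0 invr1.
  by rewrite big_nat_recr //= IH factS natrM invfM mulrC.
have K0 : 0 < K`!%:R :> R by rewrite ltr0n fact_gt0.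
have E : K`!%:R * \prod_(p <- s) ell p = tau^-1.
  have -> : \prod_(p <- s) ell p = tau ^+ 3.
    rewrite big_filter (eq_bigr (fun p => root4 (prime_index p) ^+ 3)); last first.
      by move=> p pp; rewrite /prime_symbol pp.
    by rewrite (prod_prime_index (fun i => root4 i ^+ 3)) NK prodrXl.
  have tn0 : tau != 0 by rewrite gt_eqF.
  (* tau * (K! tau^3) = 1 *)
  apply: (mulfI tn0); rewrite divff //.
  by rewrite mulrCA -exprS tau4 divff // gt_eqF.
rewrite E in h.
have -> : K`!%:R = tau^-1 ^+ 4 :> R by rewrite exprVn tau4 invrK.
by rewrite lerXn2r ?nnegrE ?conv_exp_ge0 // invr_ge0 ltW.
Qed.

End Symbol.

(** * Strict inclusion *)

Section StrictInclusion.
Variable R : realType.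
Local Notation C := R[i].
Local Notation ell := (@prime_symbol R).

(** ell^m has Volterra iterates ell^(m k) / k!, with coefficients of size
    (m k)!^(1/4) / k!. The choice m = 8 makes this at least k!. *)
Definition octic_symbol : dseries R := fun n => (conv_exp ell 8 n)%:C.
Local Notation phi := octic_symbol.

(** By [conv_dln_conv_exp] the product of ell^(8 (k + 1)) and L(ell^8) is
    1 / (k + 2) times L(ell^(8 (k + 2))). *)
Lemma volterra_octic_power k (V : dseries R) :
  (forall n, (0 < n)%N -> V n = (conv_exp ell (8 * k.+1) n / k.+1`!%:R)%:C) ->
  forall n, (0 < n)%N ->
    volterra phi V n = (conv_exp ell (8 * k.+2) n / k.+2`!%:R)%:C.
Proof.
move=> VE n n0; rewrite volterraE //.
have -> : dmul V (dlog phi) n =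
    (k.+1`!%:R^-1 * conv (conv_exp ell (8 * k.+1)) (dln (conv_exp ell 8)) n)%:C.
  rewrite /dmul /conv mulr_sumr rmorph_sum big_seq [RHS]big_seq; apply: eq_bigr => d.
  rewrite -dvdn_divisors // => dn; have d0 := dvdn_gt0 n0 dn.
  rewrite VE // /dlog /octic_symbol /dln -!real_complexM; congr (_%:C); ring.
rewrite -real_complexM; congr (_%:C).
have [n1|n1] := leqP n 1.
  have -> : n = 1%N by apply/eqP; rewrite eqn_leq n1 n0.
  by rewrite ln1 invr0 mul0r conv_exp_homogeneous ?mul0r // /bigomega add_fun1.
have L : ln (n%:R : R) != 0 by rewrite gt_eqF // ln_gt0 ?ltr1n.
have := conv_dln_conv_exp ell (8 * k.+1) 7 n0.
rewrite (_ : (8 * k.+1 + 8 = 8 * k.+2)%N); last by rewrite [RHS]mulnS addnC.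
have e8 : 8%:R != 0 :> R by rewrite pnatr_eq0.
rewrite natrM -mulrA => /(mulfI e8) E.
have k2 : k.+2%:R != 0 :> R by rewrite pnatr_eq0.
have f1 : k.+1`!%:R != 0 :> R by rewrite pnatr_eq0 -lt0n fact_gt0.
rewrite (factS k.+1) natrM; apply: (mulfI k2).
transitivity ((ln (n%:R : R))^-1 * k.+1`!%:R^-1 * (k.+2%:R * conv (conv_exp ell (8 * k.+1)) (dln (conv_exp ell 8)) n)).
  by ring.
rewrite E /dln; move: (k.+2%:R : R) k2 (k.+1`!%:R : R) f1 => a a0 b b0.
by field; rewrite L a0 b0.
Qed.

Lemma leq_exp_fact m k : (k`! ^ m <= (m * k)`!)%N.
Proof.
elim: m => [|m IH]; first by rewrite expn0 mul0n.
rewrite expnS mulSn; apply: leq_trans (leq_mul (leqnn _) IH) _.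
rewrite -(@bin_fact (k + m * k) k) ?leq_addr // addKn.
by rewrite leq_pmull // bin_gt0 leq_addr.
Qed.

Lemma octic_growth k : exists n, [/\ (0 < n)%N, bigomega n = (8 * k)%N &
  k`!%:R ^+ 2 <= conv_exp ell (8 * k) n].
Proof.
have [n [n0 on h]] := conv_exp_large R (8 * k); exists n; split=> //.
rewrite -(@ler_pXn2r _ 4) ?nnegrE ?conv_exp_ge0 ?exprn_ge0 //.
apply: le_trans h; rewrite -!natrX ler_nat -expnM; exact: leq_exp_fact.
Qed.

Lemma fact_not_exp (A B : R) : exists k, A * B ^+ k.+1 < k.+1`!%:R.
Proof.
have lim : (fun k => `|A| * exp_coeff `|B| k) @ \oo --> 0.
  rewrite -[X in _ --> X](mulr0 `|A|); apply: cvgMr.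
  by apply: cvg_series_cvg_0; exact: is_cvg_series_exp_coeff.
have [N _ hN] : \forall k \near \oo, `|A| * exp_coeff `|B| k < 1.
  by apply: cvgr_lt lim _ ltr01.
exists N; have := hN N.+1 (leqnSn N); rewrite /= /exp_coeff /= mulrA ltr_pdivrMr ?ltr0n ?fact_gt0 // mul1r.
by apply: le_lt_trans; rewrite -normrX -normrM ler_norm.
Qed.

Lemma octic_not_symbol (w : nat -> R) Y : good_weight w -> admissible w Y ->
  ~ volterra_symbols w Y phi.
Proof.
move=> gw [sub res all] [_ [M hM]].
have [w1 [c c1 wc]] := (let: And3 a _ _ := gw in a, good_weight_le_exp gw).
have phi1 : phi 1%N = 0.
  by rewrite /octic_symbol conv_exp_homogeneous // /bigomega add_fun1.
have phiH : H2 w phi.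
  have [B hB] := conv_exp_square_summable R 8.
  have [] // := @H2_bounded _ w gw phi B; move=> N; apply: le_trans (hB N).
  apply: ler_sum_nat => n /andP[n0 _]; rewrite ler_piMr ?sqmod_ge0 //.
  by rewrite invf_le1 ?good_weight_gt0 ?good_weight_ge1.
pose V k := iter k (volterra phi) phi.
have VE k n : (0 < n)%N -> V k n = (conv_exp ell (8 * k.+1) n / k.+1`!%:R)%:C.
  elim: k n => [|k IH] n n0; first by rewrite muln1 factS fact0 muln1 divr1.
  by rewrite /V iterS; apply: volterra_octic_power.
have VY k : Y (V k) /\ H2_norm w (V k) <= `|M| ^+ k * H2_norm w phi.
  elim: k => [|k [Yk le]]; first by split; [exact: all | rewrite expr0 mul1r].
  have [Y1 le1] := hM _ Yk; split; first exact: Y1.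
  apply: le_trans le1 _; rewrite exprS -mulrA.
  apply: le_trans (ler_wpM2l (normr_ge0 M) le); rewrite ler_wpM2r ?H2_norm_ge0 ?ler_norm //.
pose q := Num.max 1 `|M|.
have q1 : 1 <= q by rewrite le_max lexx.
pose A := H2_norm w phi.
have A0 : 0 <= A by exact: H2_norm_ge0.
have c0 : 0 <= c by apply: le_trans c1.
have [k hk] := fact_not_exp A (c ^+ 4 * q).
have [n [n0 on big]] := octic_growth k.+1.
have [Yk le] := VY k.
have := H2_coef_le gw (sub _ Yk) n0; rewrite VE // sqmod_real => h.
have wn : w n <= (c ^+ 4) ^+ k.+1 ^+ 2.
  apply: le_trans (wc n n0) _; rewrite on -!exprM.
  by rewrite (_ : 8 * k.+1 = 4 * (k.+1 * 2))%N //; lia.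
have f0 : 0 < k.+1`!%:R :> R by rewrite ltr0n fact_gt0.
have lower : k.+1`!%:R <= conv_exp ell (8 * k.+1) n / k.+1`!%:R.
  by rewrite ler_pdivlMr // -expr2.
have upper : w n * H2_norm w (V k) ^+ 2 <= (A * (c ^+ 4 * q) ^+ k.+1) ^+ 2.
  have -> : (A * (c ^+ 4 * q) ^+ k.+1) ^+ 2 = (c ^+ 4) ^+ k.+1 ^+ 2 * (q ^+ k.+1 * A) ^+ 2.
    by rewrite !exprMn; ring.
  apply: ler_pM; rewrite ?sqr_ge0 ?(ltW (good_weight_gt0 gw n0)) //.
  rewrite lerXn2r ?nnegrE ?H2_norm_ge0 ?mulr_ge0 ?exprn_ge0 ?(le_trans ler01 q1) //.
  apply: le_trans le _; rewrite ler_wpM2r //.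
  apply: (@le_trans _ _ (q ^+ k)); last by rewrite ler_weXn2l.
  by rewrite lerXn2r ?nnegrE ?(le_trans ler01 q1) // le_max lexx orbT.
have q0 : 0 <= q by apply: le_trans q1.
have r0 : 0 <= A * (c ^+ 4 * q) ^+ k.+1.
  by apply: mulr_ge0 => //; apply: exprn_ge0; apply: mulr_ge0 => //; exact: exprn_ge0.
have l0 : 0 <= conv_exp ell (8 * k.+1) n / k.+1`!%:R.
  by apply: le_trans lower; exact: ltW.
have := le_trans h upper; rewrite ler_pXn2r ?nnegrE // => h'.
by have := lt_le_trans hk (le_trans lower h'); rewrite ltxx.
Qed.

Lemma octic_dual (w : nat -> R) Y : good_weight w -> admissible w Y ->
  weak_product_dual w Y phi.
Proof.
move=> gw [sub _ _]; have [B hB] := conv_exp_square_summable R 8.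
apply: (@homogeneous_dual _ w 8 phi B) => //.
- apply: (@class_D_polynomial_growth _ _ 8) => n n0.
  by rewrite ger0_norm ?conv_exp_ge0 ?conv_exp_growth.
- by move=> n n0 om; rewrite /octic_symbol conv_exp_homogeneous.
Qed.

(** One symbol separates the two sets for every admissible space. *)
Lemma volterra_symbols_proper (w : nat -> R) Y : good_weight w -> admissible w Y ->
  volterra_symbols w Y `<` weak_product_dual w Y.
Proof.
move=> gw adY; split; first exact: volterra_symbols_dual.
move=> /(_ phi (octic_dual gw adY)); exact: octic_not_symbol.
Qed.

End StrictInclusion.

Theorem proposition9 (R : realType) (w : nat -> R) (hw : weight_class w) :
  volterra_symbols w (H2_0 w) `<` weak_product_dual w (H2_0 w) /\
  volterra_symbols w (H2 w) `<` weak_product_dual w (H2 w).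
Proof.
have gw := weight_class_good hw.
by split; apply: volterra_symbols_proper => //; [exact: admissible_H2_0 | exact: admissible_H2].
Qed.
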